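(* Let $K$ be a field, let $h\ge 2$ be an integer, and let $A_h$ be the numerical semigroup $$A_h=\langle h(h+1),\ h(h+1)+1,\ (h+1)^2,\ (h+1)^2+1\rangle.$$ Then the semigroup ring $K[A_h]$ and its tangent cone $\mathrm{gr}_{\mathfrak{m}}K[A_h]$ have the same Betti sequence $(1,\,2h+2,\,4h,\,2h-1)$.
   Context: $\langle b_1,\dots,b_m\rangle$ denotes the submonoid of $\mathbb{N}=\{0,1,2,\dots\}$ generated by $b_1,\dots,b_m$; a numerical semigroup is a submonoid of $\mathbb{N}$ with finite complement. The four listed integers are the minimal generators of $A_h$. For a numerical semigroup $H$ minimally generated by $b_1,\dots,b_4$, the semigroup ring $K[H]$ is the $K$-subalgebra of the univariate polynomial ring $K[s]$ generated by the monomials $s^u$, $u\in H$. Let $S=K[x,y,z,t]$ and let $I_H$ be the kernel of the $K$-algebra map $S\to K[H]$ with $x\mapsto s^{b_1}$, $y\mapsto s^{b_2}$, $z\mapsto s^{b_3}$, $t\mapsto s^{b_4}$, so $K[H]\cong S/I_H$. The tangent cone is $\mathrm{gr}_{\mathfrak{m}}K[H]=\bigoplus_{i\ge0}\mathfrak{m}^i/\mathfrak{m}^{i+1}$, where $\mathfrak{m}=(s^u: u\in H\setminus\{0\})K[H]$. It is isomorphic to $S/I_H^*$, where $I_H^*=(f^*:0\ne f\in I_H)$ and $f^*$ is the homogeneous component of smallest degree of $f$ with respect to the standard grading of $S$. The $i$-th Betti number of $M=S/I_H$ or $M=S/I_H^*$ is $\beta_i(M)=\dim_K\mathrm{Tor}_i^S(M,K)$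 with $K=S/(x,y,z,t)$, i.e. the rank of the $i$-th free module in the minimal graded free $S$-resolution of $M$. The Betti sequence is $(\beta_0,\beta_1,\beta_2,\dots)$, with the convention that only the entries up to the last nonzero one are listed. *)

(* Defs.v *)
From mathcomp Require Import all_boot all_order all_algebra.
From mathcomp Require Export mpoly.

Set Implicit Arguments.
Unset Strict Implicit.
Unset Printing Implicit Defensive.

Import GRing.Theory.
Local Open Scope ring_scope.

(* Ideals of S = K[X_0, ..., X_(n-1)] are represented by their membership
   predicate S -> Prop. *)

Section Ideals.
Variables (K : fieldType) (n : nat).
Implicit Types (f p : {mpoly K[n]}) (I : {mpoly K[n]} -> Prop).

(* I_H, for H generated by b_0, ..., b_(n-1): the kernel of S -> K[s],
   X_i |-> s^(b_i), whose image is K[H]; thus S/I_H is K[H]. *)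
Definition semigroup_ideal (b : n.-tuple nat) f : Prop :=
  mmap (@polyC K) (fun i => 'X^(tnth b i)) f = 0 :> {poly K}.

(* The least total degree of a monomial of f, for f != 0. *)
Definition mindeg f : nat := \big[minn/msize f]_(m <- msupp f) mdeg m.

Definition initial_form f : {mpoly K[n]} := pihomog mdeg (mindeg f) f.

(* I^* = (f^* : 0 != f \in I). For I = I_H, the quotient S/I^* is the tangent
   cone of K[H] at the maximal ideal (s^u : u \in H, u != 0). *)
Definition initial_ideal I p : Prop :=
  exists2 s : seq ({mpoly K[n]} * {mpoly K[n]}),
    forall x, x \in s -> x.2 != 0 /\ I x.2 &
    p = \sum_(x <- s) x.1 * initial_form x.2.

End Ideals.

Section Betti.
Variables (K : fieldType) (n : nat).
Local Notation S := {mpoly K[n]}.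
Implicit Type I : S -> Prop.

(* Free resolutions ... -> F_1 -> F_0 -> S/I -> 0 with F_i = S^(rk i) of finite
   rank. Elements of F_i are row vectors and maps act by multiplication on the
   right; the augmentation F_0 -> S/I is given by representatives in S of the
   images of the basis vectors. *)
Record free_resolution I := FreeResolution {
  rk : nat -> nat;
  aug : 'cV[S]_(rk 0);
  dif : forall i, 'M[S]_(rk i.+1, rk i);
  aug_surj : forall f : S, exists v : 'rV_(rk 0), I (f - (v *m aug) 0 0);
  aug_exact : forall v : 'rV_(rk 0),
    I ((v *m aug) 0 0) <-> exists u, v = u *m dif 0;
  dif_exact : forall i (v : 'rV_(rk i.+1)),
    v *m dif i = 0 <-> exists u, v = u *m dif i.+1
}.

(* The differentials of the complex F (x)_S K, where K = S/(X_0, ..., X_(n-1)):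
   each entry is replaced by its constant term. *)
Definition dif0 I (F : free_resolution I) i : 'M[K]_(rk F i.+1, rk F i) :=
  map_mx (mcoeff 0%MM) (dif F i).

(* dim_K Tor_i^S(S/I, K) = dim_K H_i(F (x)_S K). *)
Definition tor_dim I (F : free_resolution I) i : nat :=
  if i is j.+1 then (\rank (kermx (dif0 F j)) - \rank (dif0 F j.+1))%N
  else (rk F 0 - \rank (dif0 F 0))%N.

(* beta_i(S/I) = b. As Tor does not depend on the free resolution, any one of
   them may be used to compute it. *)
Definition betti I i b : Prop := exists F : free_resolution I, tor_dim F i = b.

(* s lists the Betti numbers of S/I up to the last nonzero one. *)
Definition betti_sequence I (s : seq nat) : Prop :=
  (forall i, betti I i (nth 0%N s i)) /\ last 1%N s != 0%N.

End Betti.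

(* The generators of A_h, in the order of the variables x, y, z, t. *)
Definition A_gens (h : nat) : 4.-tuple nat :=
  [tuple h * (h + 1); h * (h + 1) + 1; (h + 1) ^ 2; (h + 1) ^ 2 + 1]%N.

(* Main.v *)
(** Put [h = k + 1] and let [J_eps] be the ideal generated by [y z - x t],
    [F_i = z^(h-i) t^i - eps x^(h+1-i) y^i] for [i <= h] and
    [G_i = y^(h+1-i) t^i - x^(h-i) z^(i+1)] for [i < h].

    [I_H = J_1] and [I_H^* = J_0]: modulo [J_eps] every monomial is congruent
    to a power of [eps] times a standard monomial of the same weight, the
    exponent of [eps] being the increase of the degree, and distinct standard
    monomials have distinct weights.

    For every [eps], [S/J_eps] has an explicit minimal free resolution of ranks
    [1, 2h+2, 4h, 2h-1]. Vectors over [S] are written as polynomials in a new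
    variable [u], in which the differentials have short formulas. For exactness,
    a cycle is reduced modulo boundaries to a normal form, where certain
    coefficients omit certain variables. Modulo [x] the generators [F_i], [G_i]
    and [y z] are monomials, so a cycle in normal form is divisible by [x]; the
    quotient is again a cycle in normal form, hence the cycle is divisible by
    all powers of [x] and vanishes. *)
Require Import Defs.
From HB Require Import structures.
From mathcomp Require Import all_boot all_order all_algebra.
From mathcomp Require Import ring zify.

Set Implicit Arguments.
Unset Strict Implicit.
Unset Printing Implicit Defensive.

Import GRing.Theory.
Local Open Scope ring_scope.

(** The relations come from the matrix with rows [(x, y)] and [(z, t)], whose determinant is
    [x t - y z]. Modulo it, [y F_i = x F_(i+1)] and [t F_i = z F_(i+1)] for [i < h], and likewise
    [z G_i = x G_(i+1)] and [t G_i = y G_(i+1)]. These are the [4h] columns of relations, all but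
    the last [G] ones involving true generators only. The obstacle is [G_h = y t^h - z^(h+1)], which
    is not a generator: it equals [eps x G_0 + y F_h - z F_0]. This identity couples the two
    families, and it is the source of [twist] and of every correction term attached to a coefficient
    of index [k].

    The parameter [eps] occurs in the differentials only through [eps x], so it disappears modulo
    [x]. Hence the semigroup ring and the tangent cone have the same reduction modulo [x], and one
    descent along powers of [x] serves both.

    The bound [h >= 2] matters twice: for [k = 0] the forms of degree [k] in the second differential
    would be units, and [z] would not be a standard monomial. *)

Local Notation X0 := (@Ordinal 4 0 isT).
Local Notation X1 := (@Ordinal 4 1 isT).
Local Notation X2 := (@Ordinal 4 2 isT).
Local Notation X3 := (@Ordinal 4 3 isT).

(** * Setting one variable of a polynomial ring to zero *)

Section Kill.
Variables (K : fieldType) (n : nat).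
Local Notation S := {mpoly K[n]}.
Implicit Types (p q : S) (i j : 'I_n).

Lemma mpoly_closure_ind (P : S -> Prop) :
  P 1 -> (forall p q, P p -> P q -> P (p + q)) ->
  (forall c p, P p -> P (c *: p)) -> (forall i p, P p -> P ('X_i * p)) ->
  forall p, P p.
Proof.
move=> P1 PD PZ PX.
have PM m : P 'X_[m].
  elim/mpolyind: 'X_[m] => [|c m' p _ _ Pp]; first by rewrite -(scale0r 1); apply: PZ.
  apply: PD => //; apply: PZ => {c p Pp}.
  rewrite [X in P X](_ : _ = (\prod_(i < n) 'X_i ^+ m' i) * 1); last first.
    by rewrite mulr1 mpolyXE_id.
  elim/big_rec: _ => [|i q _ Pq]; first by rewrite mul1r.
  rewrite -mulrA; elim: (m' i) => [|e IH]; first by rewrite mul1r.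
  by rewrite exprS -mulrA; apply: PX.
move=> p; elim/mpolyind: p => [|c m p _ _ Pp]; first by rewrite -(scale0r 1); apply: PZ.
by apply: PD => //; apply: PZ.
Qed.

(** The quotient by ['X_j] is realized inside the same ring, as the retraction onto polynomials
    without ['X_j]. Thus [kill j p = p] says that [p] omits the variable. *)
Definition kill j (p : S) : S :=
  p \mPo [tuple if i == j then 0 else 'X_i | i < n].

HB.instance Definition _ j := GRing.RMorphism.copy (kill j)
  (comp_mpoly [tuple if i == j then 0 else 'X_i | i < n]).
HB.instance Definition _ j := GRing.Linear.copy (kill j)
  (comp_mpoly [tuple if i == j then 0 else 'X_i | i < n]).

Lemma killX j i : kill j 'X_i = if i == j then 0 else 'X_i.
Proof. by rewrite /kill comp_mpolyXU -tnth_nth tnth_mktuple. Qed.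

Lemma killC j c : kill j c%:MP = c%:MP.
Proof. exact: comp_mpolyC. Qed.

Lemma killZ j c p : kill j (c *: p) = c *: kill j p.
Proof. exact: comp_mpolyZ. Qed.

Lemma kill_comm i j p : kill i (kill j p) = kill j (kill i p).
Proof.
elim/mpoly_closure_ind: p => [|p q IHp IHq|c p IH|l p IH].
- by rewrite !rmorph1.
- by rewrite !rmorphD /= IHp IHq.
- by rewrite !killZ IH.
- rewrite !rmorphM /= IH (killX j l) (killX i l); congr (_ * _).
  by case Ej: (l == j); case Ei: (l == i);
    rewrite ?rmorph0 // ?(killX j l) ?(killX i l) ?Ei ?Ej ?rmorph0.
Qed.

Lemma killK j p : kill j (kill j p) = kill j p.
Proof.
elim/mpoly_closure_ind: p => [|p q IHp IHq|c p IH|l p IH].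
- by rewrite !rmorph1.
- by rewrite !rmorphD /= IHp IHq.
- by rewrite !killZ IH.
- rewrite !rmorphM /= IH (killX j l); congr (_ * _).
  by case: ifP => [_|E]; rewrite ?rmorph0 // killX E.
Qed.

Lemma kill_decomp j p : exists p', p = kill j p + 'X_j * p'.
Proof.
elim/mpoly_closure_ind: p => [|p q [p' Ep] [q' Eq]|c p [p' Ep]|l p [p' Ep]].
- by exists 0; rewrite rmorph1 mulr0 addr0.
- by exists (p' + q'); rewrite {1}Ep {1}Eq !rmorphD /=; ring.
- by exists (c *: p'); rewrite {1}Ep scalerDr killZ scalerAr.
- rewrite rmorphM /= killX; case: eqP => [->|_].
    by exists p; rewrite mul0r add0r.
  by exists ('X_l * p'); rewrite {1}Ep; ring.
Qed.

Lemma kill_eq0 j p : kill j p = 0 -> exists p', p = 'X_j * p'.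
Proof. by have [p' Ep] := kill_decomp j p => E; exists p'; rewrite {1}Ep E add0r. Qed.

(** Since [kill i] and [kill j] commute, applying [kill i] to any decomposition of [p] gives another
    one, whose cofactor omits ['X_i]. *)
Lemma kill_decomp_free i j p :
  kill i p = p -> i != j -> exists2 p', kill i p' = p' & p = kill j p + 'X_j * p'.
Proof.
move=> Ei ij; have [p' Ep] := kill_decomp j p.
exists (kill i p'); first exact: killK.
rewrite -{1}Ei {1}Ep rmorphD rmorphM /= kill_comm Ei killX eq_sym.
by rewrite (negPf ij).
Qed.

Lemma mpolyX_neq0 j : 'X_j != 0 :> S.
Proof. by apply/eqP => /(congr1 (fun p : S => msize p)); rewrite msizeX msize0. Qed.

(** The exponent [msize p] already suffices: sizes add up, so the cofactor has size zero. *)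
Lemma divisible_powers_eq0 j p :
  (forall e : nat, exists p', p = 'X_j ^+ e * p') -> p = 0.
Proof.
move=> H; apply/eqP; apply/negPn/negP => p0.
have [p' Ep] := H (msize p).
have p'0 : p' != 0 by apply: contraNneq p0 => E; rewrite Ep E mulr0.
have := msizeM (expf_neq0 (msize p) (mpolyX_neq0 j)) p'0.
rewrite -Ep mpolyXn msizeX mdegMn mdeg1 mul1n addSn /=.
rewrite -[X in X = _]addn0 => /addnI/esym/eqP.
by rewrite msize_poly_eq0 (negPf p'0).
Qed.

(* Distinct powers of 'X_j are independent over the subring without 'X_j. *)
Lemma kill_expansion_eq0 j (d : nat) (c : nat -> S) (q : S) :
  (forall i : nat, (i < d)%N -> kill j (c i) = c i) ->
  \sum_(i < d) c i * 'X_j ^+ i + q * 'X_j ^+ d = 0 ->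
  (forall i : nat, (i < d)%N -> c i = 0) /\ q = 0.
Proof.
elim: d c => [|d IH] c Hc.
  by rewrite big_ord0 add0r expr0 mulr1 => ->.
rewrite big_ord_recl expr0 mulr1 => E.
have c0 : c 0%N = 0.
  have := congr1 (kill j) E; rewrite rmorph0 !rmorphD rmorph_sum /= (Hc 0%N) //.
  rewrite [kill j (q * _)]rmorphM rmorphXn /= killX eqxx expr0n /= mulr0 addr0.
  rewrite big1 ?addr0 // => i _.
  by rewrite rmorphM rmorphXn /= killX eqxx expr0n mulr0.
move: E; rewrite c0 add0r => E.
have E' : 'X_j * (\sum_(i < d) c i.+1 * 'X_j ^+ i + q * 'X_j ^+ d) = 0.
  rewrite -[RHS]E mulrDr mulr_sumr exprS; congr (_ + _); last by ring.
  by apply: eq_bigr => i _; rewrite /= /bump /= add1n exprS; ring.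
move/eqP: E'; rewrite mulf_eq0 (negPf (mpolyX_neq0 j)) /= => /eqP E'.
have [H q0] := IH (fun i : nat => c i.+1) (fun (i : nat) Hi => Hc i.+1 Hi) E'.
by split=> // -[|i] Hi //; apply: H.
Qed.

End Kill.

Arguments kill {K n} j p : simpl never.

(** * Betti numbers from a minimal resolution of length three *)

Section MinimalResolution.
Variables (K : fieldType) (n : nat).
Local Notation S := {mpoly K[n]}.

(** When all constant terms of the differentials vanish, the complex tensored with [K] has zero
    differentials, and each Tor has the dimension of the corresponding free module. *)
Lemma minimal_betti_sequence (I : S -> Prop) (r1 r2 r3 : nat)
    (D1 : 'M[S]_(r1, 1)) (D2 : 'M[S]_(r2, r1)) (D3 : 'M[S]_(r3, r2)) :
  (forall p, I p <-> exists u : 'rV_r1, p = (u *m D1) 0 0) ->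
  (forall v : 'rV_r1, v *m D1 = 0 <-> exists u, v = u *m D2) ->
  (forall v : 'rV_r2, v *m D2 = 0 <-> exists u, v = u *m D3) ->
  (forall v : 'rV_r3, v *m D3 = 0 -> v = 0) ->
  map_mx (mcoeff 0%MM) D1 = 0 -> map_mx (mcoeff 0%MM) D2 = 0 ->
  map_mx (mcoeff 0%MM) D3 = 0 -> r3 != 0%N ->
  betti_sequence I [:: 1%N; r1; r2; r3].
Proof.
move=> ID1 ex1 ex2 ex3 M1 M2 M3 r30.
(* The default value of [nth] continues the resolution by modules of rank 0. *)
pose rk := nth 0%N [:: 1%N; r1; r2; r3].
pose dif (i : nat) : 'M[S]_(rk i.+1, rk i) :=
  match i with 0 => D1 | 1 => D2 | 2 => D3 | _ => 0 end.
have surj (f : S) : exists v : 'rV_(rk 0), I (f - (v *m (1%:M : 'M_1)) 0 0).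
  exists f%:M; apply/ID1; exists 0.
  by rewrite mul0mx mulmx1 mxE eqxx mulr1n subrr mxE.
have ex0 (v : 'rV_(rk 0)) :
    I ((v *m (1%:M : 'M_1)) 0 0) <-> exists u, v = u *m dif 0.
  rewrite ID1 mulmx1; split=> -[u Eu]; exists u; last by rewrite Eu.
  by apply/rowP => j; rewrite ord1 Eu.
have exS i (v : 'rV_(rk i.+1)) : v *m dif i = 0 <-> exists u, v = u *m dif i.+1.
  case: i v => [|[|[|i]]] v /=; [exact: ex1 | exact: ex2 | |].
    split=> [/ex3 ->|[u ->]]; last by rewrite mulmx0 mul0mx.
    by exists 0; rewrite mul0mx.
  split=> [_|[u ->]]; last by rewrite !mulmx0.
  exists 0; apply/rowP => -[j Hj]; exfalso; move: Hj.
  by rewrite /rk /= nth_nil.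
pose F := FreeResolution surj ex0 exS.
have F0 i : dif0 F i = 0.
  by case: i => [|[|[|i]]] //=; apply: map_mx0.
split=> // i; exists F; case: i => [|i] /=; rewrite !F0 mxrank0 subn0 //.
by rewrite mxrank_ker mxrank0 subn0.
Qed.

End MinimalResolution.

(** * Degree bounds and homogenization of polynomials in [u] *)

Section PolySize.
Variable R : comNzRingType.
Implicit Types p q : {poly R}.

Lemma le_sizeD d p q :
  (size p <= d)%N -> (size q <= d)%N -> (size (p + q)%R <= d)%N.
Proof. by move=> Hp Hq; rewrite (leq_trans (size_polyD _ _)) // geq_max Hp. Qed.

Lemma le_sizeN d p : (size p <= d)%N -> (size (- p)%R <= d)%N.
Proof. by rewrite size_polyN. Qed.

Lemma le_sizeC d (s : R) p : (size p <= d)%N -> (size (s%:P * p)%R <= d)%N.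
Proof. by move=> Hp; rewrite mul_polyC (leq_trans (size_scale_leq _ _)). Qed.

Lemma le_sizeX d p : (size p <= d)%N -> (size ('X * p)%R <= d.+1)%N.
Proof.
move=> Hp; rewrite mulrC; apply/leq_sizeP => -[|j] // Hj.
by rewrite coefMX /= (leq_sizeP _ _ Hp).
Qed.

Lemma le_sizeS d p : (size p <= d)%N -> (size p <= d.+1)%N.
Proof. exact: leqW. Qed.

Lemma le_size_const d (s : R) : (size s%:P <= d.+1)%N.
Proof. by rewrite (leq_trans (size_polyC_leq1 _)). Qed.

Lemma le_size_Xn d : (size ('X^d : {poly R}) <= d.+1)%N.
Proof. by rewrite size_polyXn. Qed.

End PolySize.

Ltac poly_size :=
  match goal with
  | H : is_true (size (polyseq ?p) <= ?d)%N |- is_true (size (polyseq ?p) <= ?d)%N => exact: H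
  | |- is_true (size (polyseq (GRing.add _ _)) <= _)%N => apply: le_sizeD; poly_size
  | |- is_true (size (polyseq (GRing.opp _)) <= _)%N => apply: le_sizeN; poly_size
  | |- is_true (size (polyseq (GRing.mul (polyC _) _)) <= _)%N => apply: le_sizeC; poly_size
  | |- is_true (size (polyseq (GRing.mul 'X _)) <= _)%N => apply: le_sizeX; poly_size
  | |- is_true (size (polyseq (polyC _)) <= _)%N => exact: le_size_const
  | |- is_true (size (polyseq (GRing.exp 'X ?d)) <= S ?d)%N => exact: le_size_Xn
  | |- is_true (size _ <= S _)%N => apply: le_sizeS; poly_size
  end.

Section Hom.
Variable R : comNzRingType.
Implicit Types (p q : {poly R}) (s v w : R).

(** The homogenization of [p] in degree [d], evaluated at [(v, w)]; multiplication by [u] becomes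
    multiplication by [w] in the next degree. Coefficients beyond [d] are cut off, whence the size
    hypothesis of [homevalS]. *)
Definition homeval d p v w : R := \sum_(i < d.+1) p`_i * v ^+ (d - i) * w ^+ i.

Lemma homevalD d p q v w : homeval d (p + q) v w = homeval d p v w + homeval d q v w.
Proof. by rewrite -big_split; apply: eq_bigr => i _; rewrite /= coefD; ring. Qed.

Lemma homevalN d p v w : homeval d (- p) v w = - homeval d p v w.
Proof. by rewrite -sumrN; apply: eq_bigr => i _; rewrite /= coefN; ring. Qed.

Lemma homevalCM d s p v w : homeval d (s%:P * p) v w = s * homeval d p v w.
Proof. by rewrite mulr_sumr; apply: eq_bigr => i _; rewrite /= coefCM; ring. Qed.

Lemma homevalC d s v w : homeval d s%:P v w = s * v ^+ d.
Proof.
rewrite /homeval big_ord_recl big1 => [|i _]; rewrite coefC //= ?mul0r //.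
by rewrite subn0 expr0; ring.
Qed.

Lemma homevalXn d v w : homeval d 'X^d v w = w ^+ d.
Proof.
rewrite /homeval big_ord_recr big1 => [|i _]; rewrite coefXn /= ?eqxx ?subnn ?expr0.
  by rewrite add0r !mul1r.
by rewrite ltn_eqF // !mul0r.
Qed.

Lemma homevalXM d p v w : homeval d.+1 ('X * p) v w = w * homeval d p v w.
Proof.
rewrite /homeval big_ord_recl coefXM /= !mul0r add0r mulr_sumr.
by apply: eq_bigr => i _; rewrite coefXM /= exprS subSS; ring.
Qed.

Lemma homevalS d p v w : (size p <= d.+1)%N -> homeval d.+1 p v w = v * homeval d p v w.
Proof.
move=> Hp; rewrite /homeval big_ord_recr /= (leq_sizeP _ _ Hp) // !mul0r addr0.
rewrite mulr_sumr; apply: eq_bigr => i _; rewrite subSn ?exprS ?leq_ord //.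
ring.
Qed.

Lemma homeval_v0 d p w : homeval d p 0 w = p`_d * w ^+ d.
Proof.
rewrite /homeval big_ord_recr big1 => [|i _] /=.
  by rewrite add0r subnn expr0 mulr1.
by rewrite expr0n subn_eq0 leqNgt ltn_ord mulr0 mul0r.
Qed.

Lemma homeval0 d v w : homeval d 0 v w = 0.
Proof. by rewrite /homeval big1 // => i _; rewrite coef0 !mul0r. Qed.

End Hom.

Lemma rmorph_homeval (R1 R2 : comNzRingType) (f : {rmorphism R1 -> R2}) d p v w :
  f (homeval d p v w) = homeval d (map_poly f p) (f v) (f w).
Proof.
rewrite /homeval rmorph_sum; apply: eq_bigr => i _.
by rewrite !rmorphM !rmorphXn coef_map.
Qed.

(** * The three differentials and the identities between them *)

Section Complex.
Variables (R : comNzRingType) (k : nat) (x y z t epsx : R).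
Implicit Types (r s : R) (f g a b c d p q : {poly R}).

(* The vector of the [G_i] satisfies [G_h = epsx * G_0] modulo the [F_i], where
   [epsx = eps * x]: this is multiplication by [u] on it, with the
   resulting [u^h] replaced by [epsx]. *)
Definition twist g : {poly R} := 'X * g - (g`_k)%:P * ('X^(k.+1) - epsx%:P).

Lemma twistD g g' : twist (g + g') = twist g + twist g'.
Proof. by rewrite /twist coefD polyCD; ring. Qed.

Lemma twistCM s g : twist (s%:P * g) = s%:P * twist g.
Proof. by rewrite /twist coefCM polyCM; ring. Qed.

Lemma twistN g : twist (- g) = - twist g.
Proof. by rewrite /twist coefN polyCN; ring. Qed.

Lemma twist0 : twist 0 = 0.
Proof. by rewrite /twist coef0 mulr0 mul0r subrr. Qed.

Lemma size_twist g : (size g <= k.+1)%N -> (size (twist g) <= k.+1)%N.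
Proof.
move=> Hg; apply/leq_sizeP => -[|j] // Hj.
rewrite /twist coefB coefXM coefCM coefB coefXn coefC /= subr0.
case: (ltngtP j k) Hj => [|Hj _|-> _]; first by lia.
  by rewrite (leq_sizeP _ _ Hg) // eqSS gtn_eqF // mulr0 subrr.
by rewrite eqxx mulr1 subrr.
Qed.

(* [r (y z - x t) + \sum_i f_i F_i + \sum_i g_i G_i]. *)
Definition diff1 r f g : R := r * (y * z - x * t) +
  (homeval k.+1 f z t - epsx * homeval k.+1 f x y) +
  (y ^+ 2 * homeval k g y t - x * z * homeval k g x z).

(** The coefficients of [a], [b], [c], [d] multiply the relations [y F_i - x F_(i+1)],
    [-(t F_i - z F_(i+1))], [z G_i - x G_(i+1)] and [t G_i - y G_(i+1)], which [diff2r] completes by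
    multiples of [y z - x t]. The last summand is the contribution
    [-(x c_k + y d_k) (y F_h - z F_0)] of [G_h]. *)
Definition diff2f a b c d : {poly R} :=
  y%:P * a - x%:P * ('X * a) - (t%:P * b - z%:P * ('X * b)) +
  (x * c`_k + y * d`_k)%:P * (z%:P - y%:P * 'X^(k.+1)).
Definition diff2g c d : {poly R} :=
  z%:P * c - x%:P * twist c + t%:P * d - y%:P * twist d.
Definition diff2r a b c d : R :=
  - homeval k a z t + epsx * homeval k b x y - y * homeval k c y t - z * homeval k d x z.

(** Koszul relations: [p] expresses that [y - x u] and [t - z u] commute, [q] that [z - x twist] and
    [t - y twist] commute. For the latter [x c_k + y d_k = (x t - y z) q_k], so the coupling term of
    [diff2f] does not vanish; the summands with [q_k] in [diff3a] and [diff3b] cancel it. *)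
Definition diff3a p q : {poly R} := z%:P * ('X * p) - t%:P * p +
  (q`_k)%:P * ((z ^+ 2)%:P - (t * y)%:P * 'X^k).
Definition diff3b p q : {poly R} := x%:P * ('X * p) - y%:P * p +
  (q`_k)%:P * ((x * z)%:P - (y ^+ 2)%:P * 'X^k).
Definition diff3c q : {poly R} := t%:P * q - y%:P * twist q.
Definition diff3d q : {poly R} := x%:P * twist q - z%:P * q.

(** The factor [v] raises the degree to [k.+1], where the replaced power [u^(k+1)] and its
    substitute [epsx] can both be evaluated. *)
Lemma homeval_twist c v w : (size c <= k.+1)%N ->
  v * homeval k (twist c) v w = w * homeval k c v w - c`_k * w ^+ k.+1 + c`_k * epsx * v ^+ k.+1.
Proof.
move=> Hc; rewrite -homevalS ?size_twist // /twist.
rewrite !(homevalD, homevalN, homevalXM, homevalCM, homevalXn, homevalC).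
ring.
Qed.

Lemma diff1_diff2 a b c d : (size a <= k.+1)%N -> (size b <= k.+1)%N ->
  (size c <= k.+1)%N -> (size d <= k.+1)%N ->
  diff1 (diff2r a b c d) (diff2f a b c d) (diff2g c d) = 0.
Proof.
move=> Ha Hb Hc Hd; rewrite /diff1 /diff2f /diff2g /diff2r.
have /eqP := homeval_twist y t Hc; rewrite -subr_eq0 => /eqP E1.
have /eqP := homeval_twist x z Hc; rewrite -subr_eq0 => /eqP E2.
have /eqP := homeval_twist y t Hd; rewrite -subr_eq0 => /eqP E3.
have /eqP := homeval_twist x z Hd; rewrite -subr_eq0 => /eqP E4.
move: (twist c) (twist d) E1 E2 E3 E4 => mc md E1 E2 E3 E4.
rewrite !(homevalD, homevalN, homevalXM, homevalCM, homevalXn, homevalC).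
rewrite !(homevalS _ _ Ha, homevalS _ _ Hb).
(* The multiples of [E1] to [E4] added here eliminate the values of [mc] and [md]: each multiplier
   is minus the coefficient of that value in [diff1], divided by the factor [v] of
   [homeval_twist]. *)
rewrite -[LHS]addr0 -[X in _ + X](mulr0 (x * y)) -[X in _ + x * y * X]E1.
rewrite -[LHS]addr0 -[X in _ + X](mulr0 (- x * z)) -[X in _ + - x * z * X]E2.
rewrite -[LHS]addr0 -[X in _ + X](mulr0 (y * y)) -[X in _ + y * y * X]E3.
rewrite -[LHS]addr0 -[X in _ + X](mulr0 (- y * z)) -[X in _ + - y * z * X]E4.
rewrite !exprS; ring.
Qed.

Lemma diff1D r f g r' f' g' : diff1 (r + r') (f + f') (g + g') = diff1 r f g + diff1 r' f' g'.
Proof. by rewrite /diff1 !homevalD; ring. Qed.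

Lemma diff1CM s r f g : diff1 (s * r) (s%:P * f) (s%:P * g) = s * diff1 r f g.
Proof. by rewrite /diff1 !homevalCM; ring. Qed.

Lemma diff2fD a b c d a' b' c' d' :
  diff2f (a + a') (b + b') (c + c') (d + d') = diff2f a b c d + diff2f a' b' c' d'.
Proof. by rewrite /diff2f !coefD !(polyCD, polyCM); ring. Qed.

Lemma diff2fCM s a b c d :
  diff2f (s%:P * a) (s%:P * b) (s%:P * c) (s%:P * d) = s%:P * diff2f a b c d.
Proof. by rewrite /diff2f !coefCM !(polyCD, polyCM); ring. Qed.

Lemma diff2f_ab0 a b :
  diff2f a b 0 0 = y%:P * a - x%:P * ('X * a) - (t%:P * b - z%:P * ('X * b)).
Proof. by rewrite /diff2f !coef0 !mulr0 addr0 mul0r addr0. Qed.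

Lemma diff2f_0cd c d :
  diff2f 0 0 c d = (x * c`_k + y * d`_k)%:P * (z%:P - y%:P * 'X^(k.+1)).
Proof. by rewrite /diff2f !mulr0 !subr0 add0r. Qed.

Lemma diff2f_split a b c d : diff2f a b c d = diff2f a b 0 0 + diff2f 0 0 c d.
Proof. by rewrite -diff2fD !addr0 !add0r. Qed.

Lemma diff2gD c d c' d' : diff2g (c + c') (d + d') = diff2g c d + diff2g c' d'.
Proof. by rewrite /diff2g !twistD; ring. Qed.

Lemma diff2gCM s c d : diff2g (s%:P * c) (s%:P * d) = s%:P * diff2g c d.
Proof. by rewrite /diff2g !twistCM; ring. Qed.

Lemma diff2g_c0 c : diff2g c 0 = z%:P * c - x%:P * twist c.
Proof. by rewrite /diff2g twist0 !mulr0 addr0 subr0. Qed.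

Lemma diff2g_0d d : diff2g 0 d = t%:P * d - y%:P * twist d.
Proof. by rewrite /diff2g twist0 !mulr0 subr0 add0r. Qed.

Lemma diff2g0 : diff2g 0 0 = 0.
Proof. by rewrite diff2g_c0 twist0 !mulr0 subrr. Qed.

Lemma diff2rD a b c d a' b' c' d' :
  diff2r (a + a') (b + b') (c + c') (d + d') = diff2r a b c d + diff2r a' b' c' d'.
Proof. by rewrite /diff2r !homevalD; ring. Qed.

Lemma diff2rCM s a b c d :
  diff2r (s%:P * a) (s%:P * b) (s%:P * c) (s%:P * d) = s * diff2r a b c d.
Proof. by rewrite /diff2r !homevalCM; ring. Qed.

Lemma diff3aD p q p' q' : diff3a (p + p') (q + q') = diff3a p q + diff3a p' q'.
Proof. by rewrite /diff3a coefD polyCD; ring. Qed.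

Lemma diff3aCM s p q : diff3a (s%:P * p) (s%:P * q) = s%:P * diff3a p q.
Proof. by rewrite /diff3a coefCM polyCM; ring. Qed.

Lemma diff3bD p q p' q' : diff3b (p + p') (q + q') = diff3b p q + diff3b p' q'.
Proof. by rewrite /diff3b coefD polyCD; ring. Qed.

Lemma diff3bCM s p q : diff3b (s%:P * p) (s%:P * q) = s%:P * diff3b p q.
Proof. by rewrite /diff3b coefCM polyCM; ring. Qed.

Lemma diff3b_0q q : diff3b 0 q = (q`_k)%:P * ((x * z)%:P - (y ^+ 2)%:P * 'X^k).
Proof. by rewrite /diff3b !mulr0 subr0 add0r. Qed.

Lemma diff3b_split p q : diff3b p q = x%:P * ('X * p) - y%:P * p + diff3b 0 q.
Proof. by rewrite diff3b_0q. Qed.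

Lemma diff3cD q q' : diff3c (q + q') = diff3c q + diff3c q'.
Proof. by rewrite /diff3c twistD; ring. Qed.

Lemma diff3cCM s q : diff3c (s%:P * q) = s%:P * diff3c q.
Proof. by rewrite /diff3c twistCM; ring. Qed.

Lemma diff3dD q q' : diff3d (q + q') = diff3d q + diff3d q'.
Proof. by rewrite /diff3d twistD; ring. Qed.

Lemma diff3dCM s q : diff3d (s%:P * q) = s%:P * diff3d q.
Proof. by rewrite /diff3d twistCM; ring. Qed.

Lemma diff3d0 : diff3d 0 = 0.
Proof. by rewrite /diff3d twist0 !mulr0 subrr. Qed.

Lemma diff3dN q : diff3d (- q) = z%:P * q - x%:P * twist q.
Proof. by rewrite /diff3d twistN; ring. Qed.

Lemma diff2g_diff3 q : diff2g (diff3c q) (diff3d q) = 0.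
Proof. by rewrite /diff2g /diff3c /diff3d !(twistD, twistN, twistCM); ring. Qed.

Lemma diff2f_diff3 p q : diff2f (diff3a p q) (diff3b p q) (diff3c q) (diff3d q) = 0.
Proof.
rewrite /diff2f /diff3c /diff3d !coefB !coefCM /diff3a /diff3b.
rewrite !expr2 exprS !(polyCB, polyCD, polyCM); ring.
Qed.

Lemma size_diff2f a b c d : (size a <= k.+1)%N -> (size b <= k.+1)%N ->
  (size (diff2f a b c d) <= k.+2)%N.
Proof. by move=> Ha Hb; rewrite /diff2f; poly_size. Qed.

Lemma size_diff2g c d : (size c <= k.+1)%N -> (size d <= k.+1)%N ->
  (size (diff2g c d) <= k.+1)%N.
Proof.
move=> Hc Hd; have Hc' := size_twist Hc; have Hd' := size_twist Hd.
by rewrite /diff2g; poly_size.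
Qed.

Lemma size_diff3a p q : (size p <= k)%N -> (size (diff3a p q) <= k.+1)%N.
Proof. by move=> Hp; rewrite /diff3a; poly_size. Qed.

Lemma size_diff3b p q : (size p <= k)%N -> (size (diff3b p q) <= k.+1)%N.
Proof. by move=> Hp; rewrite /diff3b; poly_size. Qed.

Lemma size_diff3c q : (size q <= k.+1)%N -> (size (diff3c q) <= k.+1)%N.
Proof. by move=> Hq; have Hq' := size_twist Hq; rewrite /diff3c; poly_size. Qed.

Lemma size_diff3d q : (size q <= k.+1)%N -> (size (diff3d q) <= k.+1)%N.
Proof. by move=> Hq; have Hq' := size_twist Hq; rewrite /diff3d; poly_size. Qed.

Lemma diff3_cramer q : x%:P * diff3c q + y%:P * diff3d q = (x * t - y * z)%:P * q.
Proof. by rewrite /diff3c /diff3d polyCB !polyCM; ring. Qed.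

Lemma diff3a_p0 p : diff3a p 0 = - ((t%:P - z%:P * 'X) * p).
Proof. by rewrite /diff3a coef0; ring. Qed.

End Complex.

(** * Change of rings for the differentials, and their values at the origin *)

Section ComplexMorphism.
Variables (R1 R2 : comNzRingType) (phi : {rmorphism R1 -> R2}) (k : nat).
Variables (x y z t e : R1).
Implicit Types (f g a b c d p q : {poly R1}).
Local Notation map := (map_poly phi).

Lemma map_twist g : map (twist k e g) = twist k (phi e) (map g).
Proof.
by rewrite /twist rmorphB !rmorphM rmorphB /= map_polyX map_polyXn !map_polyC coef_map.
Qed.

Lemma map_diff1 r f g : phi (diff1 k x y z t e r f g) =
  diff1 k (phi x) (phi y) (phi z) (phi t) (phi e) (phi r) (map f) (map g).
Proof. by rewrite /diff1 !expr2 !(rmorphD, rmorphN, rmorphM) /= !rmorph_homeval. Qed.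

Lemma map_diff2f a b c d : map (diff2f k x y z t a b c d) =
  diff2f k (phi x) (phi y) (phi z) (phi t) (map a) (map b) (map c) (map d).
Proof.
rewrite /diff2f !coef_map /=.
rewrite rmorphD !rmorphB !rmorphM !rmorphB !rmorphM /= map_polyXn map_polyX !map_polyC /=.
by rewrite rmorphD !rmorphM.
Qed.

Lemma map_diff2g c d : map (diff2g k x y z t e c d) =
  diff2g k (phi x) (phi y) (phi z) (phi t) (phi e) (map c) (map d).
Proof.
rewrite /diff2g -!map_twist /= -!map_polyC.
by rewrite -!rmorphM -rmorphB -rmorphD -rmorphB.
Qed.

Lemma map_diff2r a b c d : phi (diff2r k x y z t e a b c d) =
  diff2r k (phi x) (phi y) (phi z) (phi t) (phi e) (map a) (map b) (map c) (map d).
Proof. by rewrite /diff2r !(rmorphD, rmorphN, rmorphM) /= !rmorph_homeval. Qed.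

Lemma map_diff3a p q : map (diff3a k y z t p q) =
  diff3a k (phi y) (phi z) (phi t) (map p) (map q).
Proof.
rewrite /diff3a coef_map /= !expr2.
rewrite rmorphD !rmorphB !rmorphM !rmorphB !rmorphM /= map_polyXn map_polyX !map_polyC /=.
by rewrite ?rmorphM.
Qed.

Lemma map_diff3b p q : map (diff3b k x y z p q) =
  diff3b k (phi x) (phi y) (phi z) (map p) (map q).
Proof.
rewrite /diff3b coef_map /= !expr2.
rewrite rmorphD !rmorphB !rmorphM !rmorphB !rmorphM /= map_polyXn map_polyX !map_polyC /=.
by rewrite ?rmorphM.
Qed.

Lemma map_diff3c q : map (diff3c k y t e q) = diff3c k (phi y) (phi t) (phi e) (map q).
Proof. by rewrite /diff3c -map_twist -!map_polyC -!rmorphM -rmorphB. Qed.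

Lemma map_diff3d q : map (diff3d k x z e q) = diff3d k (phi x) (phi z) (phi e) (map q).
Proof. by rewrite /diff3d -map_twist -!map_polyC -!rmorphM -rmorphB. Qed.

End ComplexMorphism.

Section AtOrigin.
Variables (R : comNzRingType) (k : nat).
Implicit Types (a b c d f g p q : {poly R}).

Lemma diff1_at0 (r : R) f g : diff1 k 0 0 0 0 0 r f g = 0.
Proof. by rewrite /diff1 homeval_v0 exprS; ring. Qed.

Lemma diff2f_at0 a b c d : diff2f k 0 0 0 0 a b c d = 0.
Proof. by rewrite /diff2f polyC0; ring. Qed.

Lemma diff2g_at0 c d : diff2g k 0 0 0 0 0 c d = 0.
Proof. by rewrite /diff2g polyC0; ring. Qed.

(** The values of [homeval k] are forms of degree [k]; for [k = 0] they would be constants, and the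
    complex would not be minimal. *)
Lemma diff2r_at0 a b c d : (0 < k)%N -> diff2r k 0 0 0 0 0 a b c d = 0.
Proof.
by case: k => // k' _; rewrite /diff2r homeval_v0 exprS; ring.
Qed.

Lemma diff3a_at0 p q : diff3a k 0 0 0 p q = 0.
Proof. by rewrite /diff3a !(expr2, mul0r) polyC0; ring. Qed.

Lemma diff3b_at0 p q : diff3b k 0 0 0 p q = 0.
Proof. by rewrite /diff3b !(expr2, mul0r) polyC0; ring. Qed.

Lemma diff3c_at0 q : diff3c k 0 0 0 q = 0.
Proof. by rewrite /diff3c polyC0; ring. Qed.

Lemma diff3d_at0 q : diff3d k 0 0 0 q = 0.
Proof. by rewrite /diff3d polyC0; ring. Qed.

End AtOrigin.

(** * Normal forms modulo boundaries *)

Section PolyTools.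
Variable R : comNzRingType.
Implicit Types p : {poly R}.

Lemma poly_trunc d p : (size p <= d)%N -> p = \sum_(i < d) (p`_i)%:P * 'X^i.
Proof.
move=> Hp; transitivity (\poly_(i < d) p`_i).
  apply/polyP => i; rewrite coef_poly; case: ltnP => // Hi.
  by rewrite (leq_sizeP _ _ Hp).
by rewrite poly_def; apply: eq_bigr => i _; rewrite mul_polyC.
Qed.

Lemma size_drop_top d p :
  (size p <= d.+1)%N -> (size (p - (p`_d)%:P * 'X^d)%R <= d)%N.
Proof.
move=> Hp; apply/leq_sizeP => j Hj; rewrite coefB coefCM coefXn.
have [->|ne] := eqVneq j d; first by rewrite mulr1 subrr.
have Hj' : (d < j)%N by rewrite ltn_neqAle eq_sym ne.
by rewrite (leq_sizeP _ _ Hp j Hj') mulr0 subrr.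
Qed.

Lemma poly_shift d p : (size p <= d.+1)%N ->
  exists2 q : {poly R}, (size q <= d)%N & p = (p`_0)%:P + 'X * q.
Proof.
move=> Hp; exists (\poly_(i < d) p`_i.+1); first exact: size_poly.
apply/polyP => i; rewrite coefD coefC coefXM coef_poly.
case: i => [|i] /=; rewrite ?addr0 // add0r; case: ltnP => // Hi.
by rewrite (leq_sizeP _ _ Hp).
Qed.

Lemma coef_replace_top d p (s : R) i :
  (p - (p`_d)%:P * 'X^d + s%:P * 'X^d)`_i = if i == d then s else p`_i.
Proof.
rewrite !coefD coefN !coefCM coefXn; case: eqP => [->|_].
  by rewrite !mulr1 subrr add0r.
by rewrite !mulr0 subr0 addr0.
Qed.

Lemma coef_replace_ends d p (s : R) i :
  (p - (p`_d.+1)%:P * 'X^(d.+1) - (p`_0)%:P + s%:P)`_i =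
  if i == 0%N then s else if i == d.+1 then 0 else p`_i.
Proof.
rewrite !coefD !coefN !coefCM !coefC coefXn; case: i => [|i] /=.
  by rewrite mulr0 subr0 subrr add0r.
by case: eqP => [->|_]; rewrite subr0 addr0 (mulr1, mulr0) (subrr, subr0).
Qed.

Lemma linear_poly_neq0 (a b : R) : a != 0 -> a%:P - b%:P * 'X != 0.
Proof.
apply: contra_neq => /(congr1 (fun p : {poly R} => p`_0)).
by rewrite coefB coefC coefMX /= subr0 coef0.
Qed.

End PolyTools.

Section Reduction.
Variables (K : fieldType) (n : nat).
Local Notation S := {mpoly K[n]}.

(** Vectors with a normal form are closed under sums, so it suffices to treat [s u^i]. Building [s]
    one variable at a time, only products of a variable with a vector already in normal form have to
    be reduced. *)
Lemma normal_form_exists (d : nat) (N M : {poly S} -> Prop) :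
  N 0 -> (forall i : nat, (i < d)%N -> N 'X^i) ->
  (forall p q, N p -> N q -> N (p + q)) ->
  (forall c p, N p -> N ((c%:MP)%:P * p)) ->
  M 0 -> (forall p q, M p -> M q -> M (p + q)) ->
  (forall (s : S) p, M p -> M (s%:P * p)) ->
  (forall j v, N v -> exists2 v', N v' & M (('X_j : S)%:P * v - v')) ->
  forall p : {poly S}, (size p <= d)%N -> exists2 v, N v & M (p - v).
Proof.
move=> N0 NX ND NC M0 MD MC Nvar.
pose P p := exists2 v, N v & M (p - v).
have PD p q : P p -> P q -> P (p + q).
  move=> [v Nv Mv] [w Nw Mw]; exists (v + w); first exact: ND.
  by rewrite opprD addrACA; apply: MD.
have P0 : P 0 by exists 0; rewrite ?subrr.
move=> p Hp; rewrite (poly_trunc Hp) -/(P _).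
elim/big_ind: _ => // i _; have {Hp} := ltn_ord i.
elim/mpoly_closure_ind: (p`_i) => [|s1 s2 IH1 IH2|c s IH|j s IH] Hi.
- by rewrite mul1r; exists 'X^i; rewrite ?subrr //; apply: NX.
- by rewrite polyCD mulrDl; apply: PD; [apply: IH1 | apply: IH2].
- have [//|v Nv Mv] := IH; exists ((c%:MP)%:P * v); first exact: NC.
  by rewrite -mul_mpolyC polyCM -mulrA -mulrBr; apply: MC.
- have [//|v Nv Mv] := IH; have [v' Nv' Mv'] := Nvar j v Nv.
  exists v' => //; rewrite polyCM -mulrA.
  rewrite -[X in X - v'](subrK (('X_j : S)%:P * v)) -addrA -mulrBr.
  by apply: MD => //; apply: MC.
Qed.

End Reduction.

Section Reduce.
Variables (K : fieldType) (k : nat) (eps : K).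
Local Notation S := {mpoly K[4]}.
Local Notation x := ('X_X0 : S).
Local Notation y := ('X_X1 : S).
Local Notation z := ('X_X2 : S).
Local Notation t := ('X_X3 : S).
Local Notation epsx := (eps%:MP * x : S).
Local Notation mu := (twist k epsx).
Local Notation d2f := (diff2f k x y z t).
Local Notation d2g := (diff2g k x y z t epsx).
Local Notation d3d := (diff3d k x z epsx).
Implicit Types (r s : S) (f g a b c d n p q : {poly S}).

Lemma ord4_ind (P : 'I_4 -> Prop) : P X0 -> P X1 -> P X2 -> P X3 -> forall j, P j.
Proof.
by move=> P0 P1 P2 P3 [[|[|[|[|j]]]] Hj] //;
  match goal with H : P ?X |- P _ => rewrite (_ : Ordinal Hj = X) //; exact: val_inj end.
Qed.

Definition omits j p := map_poly (kill j) p = p.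

Lemma omits_coef j p i : omits j p -> kill j p`_i = p`_i.
Proof. by move=> Hp; rewrite -[in RHS]Hp coef_map. Qed.

Lemma omitsD j p q : omits j p -> omits j q -> omits j (p + q).
Proof. by rewrite /omits rmorphD /= => -> ->. Qed.

Lemma omits0 j : omits j 0.
Proof. exact: rmorph0. Qed.

Lemma omitsCM j s p : kill j s = s -> omits j p -> omits j (s%:P * p).
Proof. by rewrite /omits rmorphM /= map_polyC /= => -> ->. Qed.

Lemma omitsXn j i : omits j 'X^i.
Proof. by rewrite /omits map_polyXn. Qed.

Lemma kill_twist j g : j != X0 -> map_poly (kill j) (mu g) = mu (map_poly (kill j) g).
Proof.
move=> Hj; rewrite /mu !(rmorphB, rmorphM) /= map_polyX map_polyXn !map_polyC /=.
by rewrite killC killX eq_sym (negPf Hj) coef_map.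
Qed.

Lemma omits_twist j g : j != X0 -> omits j g -> omits j (mu g).
Proof. by move=> Hj Hg; rewrite /omits (kill_twist _ Hj) Hg. Qed.

Lemma omitsXM (i j : 'I_4) p : i != j -> omits j p -> omits j (('X_i : S)%:P * p).
Proof. by move=> ij; apply: omitsCM; rewrite killX (negPf ij). Qed.

(** Modulo boundaries [z] acts on [g] as [x mu] and [t] as [y mu]. Neither operator introduces [z]
    or [t], so both variables can be eliminated. *)
Lemma reduce_g g : (size g <= k.+1)%N ->
  exists n c d, [/\ [/\ (size n <= k.+1)%N, omits X2 n & omits X3 n],
    (size c <= k.+1)%N, (size d <= k.+1)%N & g = n + d2g c d].
Proof.
pose N p := [/\ (size p <= k.+1)%N, omits X2 p & omits X3 p].
pose M v := exists c d, [/\ (size c <= k.+1)%N, (size d <= k.+1)%N & v = d2g c d].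
move=> Hg; suff [n Nn [c [d [Hc Hd E]]]] : exists2 n, N n & M (g - n).
  by exists n, c, d; split=> //; rewrite -E addrC subrK.
apply: normal_form_exists Hg; rewrite {}/N {}/M.
- by split; rewrite ?size_poly0 //; apply: omits0.
- by move=> i Hi; split; rewrite ?size_polyXn //; apply: omitsXn.
- move=> p q [Hp p2 p3] [Hq q2 q3].
  by split; [poly_size | apply: omitsD | apply: omitsD].
- move=> c p [Hp p2 p3].
  by split; [poly_size | apply: omitsCM; rewrite ?killC..].
- by exists 0, 0; rewrite !size_poly0 diff2g0.
- move=> _ _ [c [d [Hc Hd ->]]] [c' [d' [Hc' Hd' ->]]].
  exists (c + c'), (d + d'); split; [poly_size.. |].
  by rewrite diff2gD.
- move=> s _ [c [d [Hc Hd ->]]].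
  exists (s%:P * c), (s%:P * d); split; [poly_size.. |].
  by rewrite diff2gCM.
- elim/ord4_ind=> v [Hv v2 v3].
  + exists (x%:P * v).
      by split; [poly_size | apply: omitsXM..].
    by exists 0, 0; rewrite !size_poly0 subrr diff2g0.
  + exists (y%:P * v).
      by split; [poly_size | apply: omitsXM..].
    by exists 0, 0; rewrite !size_poly0 subrr diff2g0.
  + exists (x%:P * mu v).
      split; first by apply: le_sizeC; apply: size_twist.
        by apply/omitsXM/omits_twist.
      by apply/omitsXM/omits_twist.
    by exists v, 0; rewrite !size_poly0 diff2g_c0.
  + exists (y%:P * mu v).
      split; first by apply: le_sizeC; apply: size_twist.
        by apply/omitsXM/omits_twist.
      by apply/omitsXM/omits_twist.
    by exists 0, v; rewrite !size_poly0 diff2g_0d.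
Qed.

(** Boundaries identify [y u^i] with [x u^(i+1)] and [z u^(i+1)] with [t u^i] for [i <= k]: the
    variable [y] is pushed up and survives only in the top coefficient, [z] is pushed down and
    survives only in the bottom one. *)
Definition normal_f f := [/\ (size f <= k.+2)%N,
  forall i : nat, (i <= k)%N -> kill X1 f`_i = f`_i &
  forall i : nat, (0 < i)%N -> kill X2 f`_i = f`_i].

Lemma reduce_f f : (size f <= k.+2)%N ->
  exists n a b, [/\ normal_f n,
    (size a <= k.+1)%N, (size b <= k.+1)%N & f = n + d2f a b 0 0].
Proof.
pose M v := exists a b, [/\ (size a <= k.+1)%N, (size b <= k.+1)%N & v = d2f a b 0 0].
move=> Hf; suff [n Nn [a [b [Ha Hb E]]]] : exists2 n, normal_f n & M (f - n).
  by exists n, a, b; split=> //; rewrite -E addrC subrK.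
apply: normal_form_exists Hf; rewrite {}/M.
- by split=> [|i _|i _]; rewrite ?size_poly0 // coef0 rmorph0.
- by move=> i Hi; split=> [|j _|j _]; rewrite ?size_polyXn // coefXn rmorph_nat.
- move=> p q [Hp p2 p3] [Hq q2 q3].
  split=> [|i Hi|i Hi]; first by poly_size.
    by rewrite coefD rmorphD /= p2 // q2.
  by rewrite coefD rmorphD /= p3 // q3.
- move=> c p [Hp p2 p3].
  split=> [|i Hi|i Hi]; first by poly_size.
    by rewrite coefCM rmorphM /= killC p2.
  by rewrite coefCM rmorphM /= killC p3.
- exists 0, 0; rewrite !size_poly0; split=> //; rewrite diff2f_ab0; ring.
- move=> _ _ [a [b [Ha Hb ->]]] [a' [b' [Ha' Hb' ->]]].
  exists (a + a'), (b + b'); split; [poly_size.. |].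
  by rewrite -diff2fD !addr0.
- move=> s _ [a [b [Ha Hb ->]]].
  exists (s%:P * a), (s%:P * b); split; [poly_size.. |].
  by rewrite -diff2fCM !mulr0.
- elim/ord4_ind=> v [Hv v2 v3].
  + exists (x%:P * v); last first.
      by exists 0, 0; rewrite !size_poly0 diff2f_ab0; split=> //; ring.
    split=> [|i Hi|i Hi]; first by poly_size.
      by rewrite coefCM rmorphM /= killX v2.
    by rewrite coefCM rmorphM /= killX v3.
  + have v02 := v2 0%N isT.
    (* Multiplication by [y] moves the part [z p'] of the bottom coefficient to a position where [z]
       is forbidden. It is brought back by [y z p' = x z p' u = x t p'] modulo boundaries, whence
       the constant [x p'] taken for [b]. *)
    have [p' p'1 Ep] := @kill_decomp_free _ _ X1 X2 _ v02 isT.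
    pose a := v - (v`_k.+1)%:P * 'X^(k.+1).
    exists (x%:P * ('X * (a - (v`_0)%:P + (kill X2 v`_0)%:P)) + (x * p' * t)%:P +
            (y * v`_k.+1)%:P * 'X^(k.+1)); last first.
      exists a, (x * p')%:P; split; [exact: size_drop_top | exact: le_size_const |].
      by rewrite diff2f_ab0 /a {1}Ep !(polyCD, polyCM); ring.
    have Ha : (size a <= k.+1)%N by apply: size_drop_top.
    split.
    * by poly_size.
    * move=> [|i] Hi; rewrite !coefD !coefCM !coefXM !coefC !coefXn /=.
        by rewrite mulr0 add0r mulr0 addr0 !rmorphM /= !killX p'1.
      rewrite addr0 ?eqSS (ltn_eqF Hi) mulr0 addr0 rmorphM /= killX.
      congr (_ * _); rewrite coef_replace_ends.
      case: i Hi => [|i] Hi /=; first by rewrite kill_comm v02.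
      by rewrite eqSS (ltn_eqF (ltnW Hi)) v2 // ltnW.
    * move=> [|i] // _; rewrite !coefD !coefCM !coefXM !coefC !coefXn /= addr0.
      rewrite rmorphD !rmorphM /= !killX rmorph_nat (v3 k.+1) // coef_replace_ends.
      case: i => [|i] /=; first by rewrite killK.
      by case: ifP => _; rewrite ?rmorph0 // v3.
  + have [b Hb Ev] := poly_shift Hv.
    have Eb i : b`_i = v`_i.+1 by rewrite Ev coefD coefC coefXM /= add0r.
    have v13 := v3 k.+1 isT.
    have v02 := v2 0%N isT.
    have coef_top i : (b - (v`_k.+1)%:P * 'X^k + (kill X1 v`_k.+1)%:P * 'X^k)`_i =
        if i == k then kill X1 v`_k.+1 else b`_i.
      by rewrite -Eb coef_replace_top.
    (* Symmetrically, multiplication by [z] moves the part [y p'] of the top coefficient down to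
       [u^k], where [y] is forbidden; [y t p' u^k = x t p' u^(k+1)] modulo boundaries, whence the
       witness [t p' u^k] for [a]. *)
    have [p' p'1 Ep] := @kill_decomp_free _ _ X2 X1 _ v13 isT.
    exists ((z * v`_0)%:P + t%:P * (b - (v`_k.+1)%:P * 'X^k + (kill X1 v`_k.+1)%:P * 'X^k)
      + (x * p' * t)%:P * 'X^(k.+1)); last first.
      exists ((t * p')%:P * 'X^k), b; split => //; first by poly_size.
      by rewrite diff2f_ab0 {1}Ev {1}Ep !(polyCD, polyCM) exprS; ring.
    split.
    * by poly_size.
    * move=> i Hi; rewrite coefD coefD coefC !coefCM coefXn coef_top.
      rewrite (ltn_eqF (Hi : (i < k.+1)%N)) mulr0 addr0 rmorphD; congr (_ + _).
        by case: eqP => _; rewrite ?rmorph0 // rmorphM /= killX v02.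
      rewrite rmorphM /= killX; congr (_ * _); case: eqP => [_|/eqP ne].
        exact: killK.
      by rewrite Eb v2 // ltn_neqAle ne.
    * move=> [|i] // _; rewrite coefD coefD coefC !coefCM coefXn coef_top /= add0r.
      rewrite rmorphD !rmorphM /= !killX rmorph_nat p'1; congr (_ * _ + _).
      by case: eqP => _; [rewrite kill_comm v13 | rewrite Eb v3].
  + exists (t%:P * v); last first.
      by exists 0, 0; rewrite !size_poly0 diff2f_ab0; split=> //; ring.
    split=> [|i Hi|i Hi]; first by poly_size.
      by rewrite coefCM rmorphM /= killX v2.
    by rewrite coefCM rmorphM /= killX v3.
Qed.

(** Modulo the image of [d3d], [z] acts as [x mu], which introduces no [z]. *)
Lemma reduce_d d : (size d <= k.+1)%N ->
  exists n q, [/\ (size n <= k.+1)%N, omits X2 n,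
    (size q <= k.+1)%N & d = n + d3d q].
Proof.
pose N p := (size p <= k.+1)%N /\ omits X2 p.
pose M v := exists q, (size q <= k.+1)%N /\ v = d3d q.
move=> Hd; suff [n [? ?] [q [Hq E]]] : exists2 n, N n & M (d - n).
  by exists n, q; split=> //; rewrite -E addrC subrK.
apply: normal_form_exists Hd; rewrite {}/N {}/M.
- by split; rewrite ?size_poly0 //; apply: omits0.
- by move=> i Hi; split; rewrite ?size_polyXn //; apply: omitsXn.
- move=> p q [Hp p2] [Hq q2]; split; [poly_size | exact: omitsD].
- move=> c p [Hp p2]; split; [poly_size | by apply: omitsCM; rewrite ?killC].
- by exists 0; rewrite !size_poly0 diff3d0.
- move=> _ _ [q [Hq ->]] [q' [Hq' ->]]; exists (q + q'); split; first by poly_size.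
  by rewrite diff3dD.
- move=> s _ [q [Hq ->]]; exists (s%:P * q); split; first by poly_size.
  by rewrite diff3dCM.
- elim/ord4_ind=> v [Hv v2]; [exists (x%:P * v)|exists (y%:P * v)| |exists (t%:P * v)].
  1,3,6: by split; [poly_size | apply: omitsXM].
  1,2,4: by exists 0; rewrite size_poly0 subrr diff3d0.
  exists (x%:P * mu v).
    split; first by apply: le_sizeC; apply: size_twist.
    by apply/omitsXM/omits_twist.
  by exists (- v); rewrite size_polyN diff3dN.
Qed.

(** Here [y u^i] is replaced by [x u^(i+1)] for [i < k]; the bound on [p] leaves the coefficient of
    [u^k] unrestricted. *)
Lemma reduce_b b : (size b <= k.+1)%N ->
  exists n p, [/\ (size n <= k.+1)%N, forall i : nat, (i < k)%N -> kill X1 n`_i = n`_i,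
    (size p <= k)%N & b = n + (x%:P * ('X * p) - y%:P * p)].
Proof.
pose N p := (size p <= k.+1)%N /\ forall i : nat, (i < k)%N -> kill X1 p`_i = p`_i.
pose M v := exists p, (size p <= k)%N /\ v = x%:P * ('X * p) - y%:P * p.
move=> Hb; suff [n [? ?] [q [Hq E]]] : exists2 n, N n & M (b - n).
  by exists n, q; split=> //; rewrite -E addrC subrK.
apply: normal_form_exists Hb; rewrite {}/N {}/M.
- by split=> [|i _]; rewrite ?size_poly0 // coef0 rmorph0.
- by move=> i Hi; split=> [|j _]; rewrite ?size_polyXn // coefXn rmorph_nat.
- move=> p q [Hp p2] [Hq q2]; split=> [|i Hi]; first by poly_size.
  by rewrite coefD rmorphD /= p2 // q2.
- move=> c p [Hp p2]; split=> [|i Hi]; first by poly_size.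
  by rewrite coefCM rmorphM /= killC p2.
- by exists 0; rewrite !size_poly0; split=> //; ring.
- move=> _ _ [q [Hq ->]] [q' [Hq' ->]]; exists (q + q'); split; first by poly_size.
  ring.
- move=> s _ [q [Hq ->]]; exists (s%:P * q); split; first by poly_size.
  ring.
- elim/ord4_ind=> v [Hv v2]; [exists (x%:P * v)| |exists (z%:P * v)|exists (t%:P * v)].
  1,4,6: by split=> [|i Hi]; [poly_size | rewrite coefCM rmorphM /= killX v2].
  1,3,4: by exists 0; rewrite size_poly0; split=> //; ring.
  pose p := v - (v`_k)%:P * 'X^k.
  have Hp : (size p <= k)%N by apply: size_drop_top.
  exists ((y * v`_k)%:P * 'X^k + x%:P * ('X * p)); last first.
    exists (- p); rewrite size_polyN; split=> //; rewrite polyCM /p; ring.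
  split=> [|i Hi]; first by poly_size.
  rewrite !coefD !coefCM !coefXM !coefXn ltn_eqF // mulr0 add0r rmorphM /= killX.
  congr (_ * _); case: i Hi => [|i] Hi /=; first by rewrite rmorph0.
  by rewrite /p coefB coefCM coefXn ltn_eqF ?(ltnW Hi) // mulr0 subr0 v2 // ltnW.
Qed.

End Reduce.

Lemma subr_split (V : zmodType) (a b c d e : V) :
  a - b = c + d -> e = d + b -> a = c + e.
Proof. by move=> E ->; rewrite addrA -E subrK. Qed.

(** * Exactness by descent along the powers of [x] *)

Section Exactness.
Variables (K : fieldType) (k : nat) (eps : K).
Local Notation S := {mpoly K[4]}.
Local Notation x := ('X_X0 : S).
Local Notation y := ('X_X1 : S).
Local Notation z := ('X_X2 : S).
Local Notation t := ('X_X3 : S).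
Local Notation epsx := (eps%:MP * x : S).
Local Notation mu := (twist k epsx).
Local Notation d1 := (diff1 k x y z t epsx).
Local Notation d2f := (diff2f k x y z t).
Local Notation d2g := (diff2g k x y z t epsx).
Local Notation d2r := (diff2r k x y z t epsx).
Local Notation d3a := (diff3a k y z t).
Local Notation d3b := (diff3b k x y z).
Local Notation d3c := (diff3c k y t epsx).
Local Notation d3d := (diff3d k x z epsx).
Local Notation kx := (map_poly (kill X0)).
Implicit Types (r s : S) (f g a b c d n p q : {poly S}).

Lemma kill_poly_eq0 j p : map_poly (kill j) p = 0 -> exists p', p = ('X_j : S)%:P * p'.
Proof.
move=> Hp; rewrite (poly_trunc (leqnn (size p))).
elim/big_ind: _ => [|_ _ [p1 ->] [p2 ->]|i _]; first by exists 0; rewrite mulr0.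
  by exists (p1 + p2); rewrite mulrDr.
have /kill_eq0 [s Es] : kill j p`_i = 0 by rewrite -coef_map Hp coef0.
by exists (s%:P * 'X^i); rewrite Es polyCM mulrA.
Qed.

Lemma polyX_divisible_eq0 j p :
  (forall e : nat, exists p', p = (('X_j : S) ^+ e)%:P * p') -> p = 0.
Proof.
move=> H; apply/polyP => i; rewrite coef0; apply: (@divisible_powers_eq0 _ _ j) => e.
by have [p' Ep] := H e; exists p'`_i; rewrite {1}Ep coefCM.
Qed.

Lemma polyX_cancel (j : 'I_4) p q : ('X_j : S)%:P * p = ('X_j : S)%:P * q -> p = q.
Proof. by apply: mulfI; rewrite polyC_eq0 mpolyX_neq0. Qed.

Lemma size_polyXM (j : 'I_4) (m : nat) p :
  (size (('X_j : S)%:P * p)%R <= m)%N -> (size p <= m)%N.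
Proof. by rewrite mul_polyC size_scale ?mpolyX_neq0. Qed.

Lemma omits_kx j p : omits j p -> omits j (kx p).
Proof.
move=> Hp; apply/polyP => i; rewrite !coef_map /= kill_comm.
by rewrite (omits_coef _ Hp).
Qed.

Lemma size_kx p (m : nat) : (size p <= m)%N -> (size (kx p) <= m)%N.
Proof.
by move=> Hp; apply/leq_sizeP => j Hj; rewrite coef_map /= (leq_sizeP _ _ Hp j Hj) rmorph0.
Qed.

Lemma omits_div_x j p : j != X0 -> omits j (x%:P * p) -> omits j p.
Proof.
move=> Hj; rewrite /omits rmorphM /= map_polyC /= killX eq_sym (negPf Hj).
exact: polyX_cancel.
Qed.

Lemma kill_div_x j s : j != X0 -> kill j (x * s) = x * s -> kill j s = s.
Proof.
move=> Hj; rewrite rmorphM /= killX eq_sym (negPf Hj).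
exact/mulfI/mpolyX_neq0.
Qed.

Lemma normal_f_kx f : normal_f k f -> normal_f k (kx f).
Proof.
case=> Hf f1 f2; split=> [|i Hi|i Hi]; first exact: size_kx.
  by rewrite coef_map /= kill_comm f1.
by rewrite coef_map /= kill_comm f2.
Qed.

Lemma normal_f_div_x f : normal_f k (x%:P * f) -> normal_f k f.
Proof.
case=> Hf f1 f2; split=> [|i Hi|i Hi]; first exact: size_polyXM Hf.
  by apply: kill_div_x => //; rewrite -coefCM f1.
by apply: kill_div_x => //; rewrite -coefCM f2.
Qed.

(* Modulo x the generators become monomials, and the terms of a normal form
   have pairwise distinct monomials. *)
Lemma diff1_normal_mod_x r f g : normal_f k f ->
  (size g <= k.+1)%N -> omits X2 g -> omits X3 g ->
  diff1 k 0 y z t 0 r f g = 0 -> [/\ r = 0, f = 0 & g = 0].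
Proof.
move=> [Hf f1 f2] Hg g2 g3; rewrite /diff1 !mul0r !subr0 => E.
(* Setting [z = 0] leaves [g] and the top coefficient of [f], separated by the powers of [t]. The
   coefficients of [g] omit [t]; that of [f] may contain it and is the remainder of the
   expansion. *)
have Ez : \sum_(i < k.+1) (y ^+ 2 * g`_i * y ^+ (k - i)) * t ^+ i +
    f`_k.+1 * t ^+ k.+1 = 0.
  have := congr1 (kill X2) E; rewrite rmorph0 !rmorphD !rmorphM /= !killX /=.
  rewrite mulr0 mulr0 add0r !rmorph_homeval /= !killX /= homeval_v0 coef_map /= (f2 k.+1 isT) g2.
  move=> Ek; rewrite -[RHS]Ek addrC; congr (_ + _); rewrite /homeval mulr_sumr.
  by apply: eq_bigr => i _; rewrite !mulrA.
have [g0 fk0] : (forall i : nat, (i < k.+1)%N -> y ^+ 2 * g`_i * y ^+ (k - i) = 0) /\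
    f`_k.+1 = 0.
  apply: kill_expansion_eq0 Ez => i Hi.
  by rewrite !rmorphM !rmorphXn /= !killX omits_coef.
have {g0}g0 : g = 0.
  apply/polyP => i; rewrite coef0; case: (ltnP i k.+1) => Hi; last first.
    by rewrite (leq_sizeP _ _ Hg).
  have /eqP := g0 i Hi; rewrite !mulf_eq0 !expf_eq0 (negPf (mpolyX_neq0 _ _)) !andbF.
  by rewrite orbF => /eqP.
move: E; rewrite g0 homeval0 mulr0 addr0 => E.
have Hf' : (size f <= k.+1)%N.
  apply/leq_sizeP => i; rewrite leq_eqVlt => /predU1P[<- //|Hi].
  by rewrite (leq_sizeP _ _ Hf).
have {}E : r * y + homeval k f z t = 0.
  apply: (mulfI (mpolyX_neq0 K X2)); rewrite mulr0 -[RHS]E homevalS // mulrDr.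
  by congr (_ + _); rewrite mulrCA [z * y]mulrC.
(* With the factor [z] cancelled, setting [y = 0] removes [r]. The rest is an expansion in powers of
   [z], with the bottom coefficient as remainder because it may contain [z]. *)
have Ey : \sum_(i < k) (f`_(k - i) * t ^+ (k - i)) * z ^+ i + f`_0 * z ^+ k = 0.
  have := congr1 (kill X1) E; rewrite rmorph0 rmorphD rmorphM /= !killX /=.
  rewrite mulr0 add0r rmorph_homeval /= !killX /=.
  have -> : map_poly (kill X1) f = f.
    apply/polyP => i; rewrite coef_map /=; case: (leqP i k) => Hi; first exact: f1.
    by rewrite (leq_sizeP _ _ Hf') // rmorph0.
  move=> Ek; rewrite -[RHS]Ek /homeval [RHS](reindex_inj rev_ord_inj) [RHS]big_ord_recr /=.
  rewrite subnn subn0 expr0 mulr1; congr (_ + _).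
  by apply: eq_bigr => i _; rewrite (subKn (ltnW (ltn_ord i))) mulrAC.
have [f0 f00] : (forall i : nat, (i < k)%N -> f`_(k - i) * t ^+ (k - i) = 0) /\ f`_0 = 0.
  apply: kill_expansion_eq0 Ey => i Hi.
  by rewrite rmorphM rmorphXn /= killX f2 // subn_gt0.
have {f0 f00}f0 : f = 0.
  apply/polyP => -[|i]; rewrite coef0 //; case: (ltnP i k) => Hi; last first.
    by rewrite (leq_sizeP _ _ Hf').
  have Hi' : (k - i.+1 < k)%N by lia.
  have /eqP := f0 _ Hi'; rewrite subKn // mulf_eq0 expf_eq0 (negPf (mpolyX_neq0 _ _)).
  by rewrite andbF orbF => /eqP.
split=> //; move/eqP: E; rewrite f0 homeval0 addr0 mulf_eq0.
by rewrite (negPf (mpolyX_neq0 _ _)) orbF => /eqP.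
Qed.

(** The normal form conditions concern variables other than [x], so they pass to the quotient by
    [x], and the descent can be iterated. *)
Lemma diff1_normal_eq0 r f g : normal_f k f ->
  (size g <= k.+1)%N -> omits X2 g -> omits X3 g ->
  d1 r f g = 0 -> [/\ r = 0, f = 0 & g = 0].
Proof.
move=> Nf Hg g2 g3 E.
suff H (e : nat) : exists r' f' g', [/\ r = x ^+ e * r', f = (x ^+ e)%:P * f',
    g = (x ^+ e)%:P * g', [/\ normal_f k f', (size g' <= k.+1)%N, omits X2 g' & omits X3 g'] &
    d1 r' f' g' = 0].
  split; [apply: (@divisible_powers_eq0 _ _ X0)|
          apply: (@polyX_divisible_eq0 X0)|apply: (@polyX_divisible_eq0 X0)] => e;
  have [r' [f' [g' [Er Ef Eg _ _]]]] := H e; by [exists r'|exists f'|exists g'].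
elim: e => [|e [r' [f' [g' [Er Ef Eg [Nf' Hg' g2' g3'] E']]]]].
  by exists r, f, g; rewrite expr0 !mul1r.
have := congr1 (kill X0) E'; rewrite rmorph0 map_diff1 rmorphM /= !killX /= mulr0.
case/(diff1_normal_mod_x (normal_f_kx Nf') (size_kx Hg') (omits_kx g2') (omits_kx g3')).
move=> /kill_eq0 [r1 E1] /kill_poly_eq0 [f1 F1] /kill_poly_eq0 [g1 G1].
exists r1, f1, g1; split.
- by rewrite exprSr -mulrA -E1.
- by rewrite exprSr polyCM -mulrA -F1.
- by rewrite exprSr polyCM -mulrA -G1.
- rewrite F1 in Nf'; rewrite G1 in Hg' g2' g3'; split.
  + exact: normal_f_div_x Nf'.
  + exact: size_polyXM Hg'.
  + exact: (omits_div_x _ g2').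
  + exact: (omits_div_x _ g3').
- apply: (mulfI (mpolyX_neq0 K X0)); rewrite mulr0 -[RHS]E' E1 F1 G1.
  by rewrite -diff1CM.
Qed.

(** The reductions are triangular: [c] and [d] normalize [g] but disturb [f] through the coupling
    term, after which [a] and [b] normalize [f] without affecting [g]. *)
Lemma diff1_exact r f g : (size f <= k.+2)%N -> (size g <= k.+1)%N -> d1 r f g = 0 ->
  exists a b c d, [/\ [/\ (size a <= k.+1)%N, (size b <= k.+1)%N,
    (size c <= k.+1)%N & (size d <= k.+1)%N],
    r = d2r a b c d, f = d2f a b c d & g = d2g c d].
Proof.
move=> Hf Hg E.
have [n [c [d [[Hn n2 n3] Hc Hd Eg]]]] := reduce_g eps Hg.
have Hf' : (size (f - d2f 0 0 c d)%R <= k.+2)%N.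
  by rewrite diff2f_0cd; poly_size.
have [m [a [b [Nm Ha Hb Ef]]]] := reduce_f Hf'.
have Ef' : f = m + d2f a b c d.
  exact: (subr_split Ef (diff2f_split _ _ _ _ _ _ _ _ _)).
have E2 := diff1_diff2 x y z t epsx Ha Hb Hc Hd.
have E1 : d1 (r - d2r a b c d) m n = 0.
  apply: (addIr (d1 (d2r a b c d) (d2f a b c d) (d2g c d))).
  by rewrite -diff1D subrK -Ef' -Eg E E2 addr0.
have [r0 m0 n0] := diff1_normal_eq0 Nm Hn n2 n3 E1.
exists a, b, c, d; split=> //; last by rewrite Eg n0 add0r.
  by apply/eqP; rewrite -subr_eq0 r0.
by rewrite Ef' m0 add0r.
Qed.

(** Modulo [x] the wrap-around of [twist] disappears and it becomes a truncated shift. At [z = 0]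
    this gives [t d_i = y d_(i-1)] with [d_(-1) = 0], so [d] vanishes from the bottom up, and [c]
    with it. *)
Lemma diff2_normal_mod_x a b c d : (size a <= k.+1)%N -> (size b <= k.+1)%N ->
  (size c <= k.+1)%N -> (size d <= k.+1)%N -> omits X2 d ->
  (forall i : nat, (i < k)%N -> kill X1 b`_i = b`_i) ->
  diff2f k 0 y z t a b c d = 0 -> diff2g k 0 y z t 0 c d = 0 ->
  [/\ a = 0, b = 0, c = 0 & d = 0].
Proof.
move=> Ha Hb Hc Hd d2 b1; rewrite /diff2g mul0r subr0 => Ef Eg.
have muE i : (i <= k)%N -> (twist k 0 d)`_i = if i is i'.+1 then d`_i' else 0.
  move=> Hi; rewrite /twist subr0 coefB coefXM coefCM coefXn.
  rewrite (ltn_eqF (Hi : (i < k.+1)%N)) mulr0 subr0.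
  by case: i Hi.
have Ed : t%:P * d = y%:P * twist k 0 d.
  apply/eqP; rewrite -subr_eq0; apply/eqP.
  have := congr1 (map_poly (kill X2)) Eg.
  rewrite rmorph0 rmorphB rmorphD !rmorphM /= !map_polyC /= !killX /=.
  by rewrite mul0r add0r map_twist /= rmorph0 d2.
have d0 : d = 0.
  apply/polyP => i; rewrite coef0; case: (leqP i k) => [Hi|Hi]; last first.
    by rewrite (leq_sizeP _ _ Hd).
  have Ei (j : nat) : t * d`_j = y * (twist k 0 d)`_j by rewrite -!coefCM Ed.
  elim: i Hi => [|i IH] Hi; apply: (mulfI (mpolyX_neq0 K X3)).
    by rewrite mulr0 Ei (muE _ Hi) mulr0.
  by rewrite mulr0 Ei (muE _ Hi) (IH (ltnW Hi)) mulr0.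
have c0 : c = 0.
  move/eqP: Eg; rewrite d0 twist0 !mulr0 addr0 subr0 mulf_eq0 polyC_eq0.
  by rewrite (negPf (mpolyX_neq0 _ _)) => /eqP.
move: Ef; rewrite c0 d0 diff2f_ab0 mul0r subr0 => Ef.
(* The top coefficient of [b] is the one allowed to contain [y]; the coefficient of [u^(k+1)] in
   [Ef] is [z] times it. Then all of [b] omits [y], and setting [y = 0] leaves [(t - z u) b = 0]. *)
have bk : b`_k = 0.
  have /= := congr1 (fun p : {poly S} => p`_k.+1) Ef.
  rewrite coef0 !coefB !coefCM coefXM /= (leq_sizeP _ _ Ha) // (leq_sizeP _ _ Hb) //.
  rewrite !mulr0 !sub0r opprK => /eqP.
  by rewrite mulf_eq0 (negPf (mpolyX_neq0 _ _)) => /eqP.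
have {}b1 : map_poly (kill X1) b = b.
  apply/polyP => i; rewrite coef_map /=; case: (ltngtP i k) => [|Hi|->]; first exact: b1.
    by rewrite (leq_sizeP _ _ Hb) // rmorph0.
  by rewrite bk rmorph0.
have b0 : b = 0.
  have := congr1 (map_poly (kill X1)) Ef.
  rewrite rmorph0 !rmorphB !rmorphM /= !map_polyC /= map_polyX !killX /= b1 mul0r sub0r.
  move/eqP; rewrite oppr_eq0 mulrA -mulrBl mulf_eq0.
  by rewrite (negPf (linear_poly_neq0 _ (mpolyX_neq0 _ _))) => /eqP.
split=> //; move/eqP: Ef; rewrite b0 !mulr0 !subr0 mulf_eq0 polyC_eq0.
by rewrite (negPf (mpolyX_neq0 _ _)) => /eqP.
Qed.

Lemma diff2_normal_eq0 a b c d : (size a <= k.+1)%N -> (size b <= k.+1)%N ->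
  (size c <= k.+1)%N -> (size d <= k.+1)%N -> omits X2 d ->
  (forall i : nat, (i < k)%N -> kill X1 b`_i = b`_i) ->
  d2f a b c d = 0 -> d2g c d = 0 -> [/\ a = 0, b = 0, c = 0 & d = 0].
Proof.
move=> Ha Hb Hc Hd d2 b1 Ef Eg.
suff H (e : nat) : exists a' b' c' d',
    [/\ [/\ a = (x ^+ e)%:P * a', b = (x ^+ e)%:P * b',
      c = (x ^+ e)%:P * c' & d = (x ^+ e)%:P * d'],
    [/\ (size a' <= k.+1)%N, (size b' <= k.+1)%N, (size c' <= k.+1)%N &
      (size d' <= k.+1)%N], omits X2 d',
    forall i : nat, (i < k)%N -> kill X1 b'`_i = b'`_i &
    d2f a' b' c' d' = 0 /\ d2g c' d' = 0].
  split; apply: (@polyX_divisible_eq0 X0) => e;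
  have [a' [b' [c' [d' [[Ea Eb Ec Ed] _ _ _ _]]]]] := H e;
  by [exists a'|exists b'|exists c'|exists d'].
elim: e => [|e].
  by exists a, b, c, d; rewrite expr0 !mul1r.
case=> a' [b' [c' [d' [[Ea Eb Ec Ed] [Ha' Hb' Hc' Hd'] d2' b1' [Ef' Eg']]]]].
have := congr1 kx Eg'; rewrite rmorph0 map_diff2g rmorphM /= !killX /= mulr0.
have := congr1 kx Ef'; rewrite rmorph0 map_diff2f /= !killX /=.
move=> /diff2_normal_mod_x/[apply].
case; try exact: size_kx; first exact: omits_kx.
  by move=> i Hi; rewrite coef_map /= kill_comm b1'.
move=> /kill_poly_eq0 [a1 A1] /kill_poly_eq0 [b2 B1] /kill_poly_eq0 [c1 C1] /kill_poly_eq0 [e1 D1].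
exists a1, b2, c1, e1; split.
- by split; rewrite exprSr polyCM -mulrA -?A1 -?B1 -?C1 -?D1.
- rewrite A1 in Ha'; rewrite B1 in Hb'; rewrite C1 in Hc'; rewrite D1 in Hd'.
  by split; [exact: size_polyXM Ha' | exact: size_polyXM Hb'
            | exact: size_polyXM Hc' | exact: size_polyXM Hd'].
- by rewrite D1 in d2'; exact: (omits_div_x _ d2').
- by move=> i Hi; apply: kill_div_x => //; rewrite -coefCM -B1 b1'.
- split; apply: (@polyX_cancel X0); rewrite mulr0.
    by rewrite -diff2fCM -A1 -B1 -C1 -D1.
  by rewrite -diff2gCM -C1 -D1.
Qed.

(** [q] is chosen first to normalize [d], since it also changes [b]; then [p] normalizes [b] and
    leaves [c] and [d] alone. Normalizing these two components is enough to force all four to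
    vanish. *)
Lemma diff2_exact a b c d : (size a <= k.+1)%N -> (size b <= k.+1)%N ->
  (size c <= k.+1)%N -> (size d <= k.+1)%N -> d2f a b c d = 0 -> d2g c d = 0 ->
  exists p q, [/\ (size p <= k)%N, (size q <= k.+1)%N &
    [/\ a = d3a p q, b = d3b p q, c = d3c q & d = d3d q]].
Proof.
move=> Ha Hb Hc Hd Ef Eg.
have [n [q [Hn n2 Hq Ed]]] := reduce_d eps Hd.
have Hb' : (size (b - d3b 0 q)%R <= k.+1)%N.
  by rewrite diff3b_0q; poly_size.
have [m [p [Hm m1 Hp Eb]]] := reduce_b Hb'.
have Eb' : b = m + d3b p q.
  exact: (subr_split Eb (diff3b_split _ _ _ _ _ _)).
have [a0 b0 c0 d0] : [/\ a - d3a p q = 0, m = 0, c - d3c q = 0 & n = 0].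
  have Hmu := size_twist epsx Hq.
  apply: (diff2_normal_eq0 _ Hm _ Hn n2 m1).
  - exact/le_sizeD/le_sizeN/size_diff3a.
  - exact/le_sizeD/le_sizeN/size_diff3c.
  - apply: (addIr (d2f (d3a p q) (d3b p q) (d3c q) (d3d q))).
    by rewrite -diff2fD (subrK _ a) (subrK _ c) -Eb' -Ed Ef diff2f_diff3 addr0.
  - apply: (addIr (d2g (d3c q) (d3d q))).
    by rewrite -diff2gD (subrK _ c) -Ed Eg diff2g_diff3 addr0.
exists p, q; split; [exact: Hp | exact: Hq | split].
- by apply/eqP; rewrite -subr_eq0 a0.
- by rewrite Eb' b0 add0r.
- by apply/eqP; rewrite -subr_eq0 c0.
- by rewrite Ed d0 add0r.
Qed.

Lemma quadric_neq0 : y * z - x * t != 0.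
Proof.
apply/eqP => /(congr1 (kill X0)); rewrite rmorph0 rmorphB !rmorphM /= !killX /=.
rewrite mul0r subr0 => /eqP; rewrite mulf_eq0.
by rewrite !(negPf (mpolyX_neq0 _ _)).
Qed.

(** Since the [f] and [g] components vanish, [diff1_diff2] says that this component times
    [y z - x t] is zero, and the quadric is a nonzerodivisor. *)
Lemma diff2r_diff3 p q : (size p <= k)%N -> (size q <= k.+1)%N ->
  d2r (d3a p q) (d3b p q) (d3c q) (d3d q) = 0.
Proof.
move=> Hp Hq.
have := diff1_diff2 x y z t epsx (size_diff3a y z t q Hp) (size_diff3b x y z q Hp)
  (size_diff3c y t epsx Hq) (size_diff3d x z epsx Hq).
rewrite diff2f_diff3 diff2g_diff3 /diff1 !homeval0 !mulr0 subrr !addr0 => /eqP.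
by rewrite mulf_eq0 (negPf quadric_neq0) orbF => /eqP.
Qed.

(** Cramer's rule eliminates [twist q] and leaves [(x t - y z) q = 0]; then [(t - z u) p = 0]. *)
Lemma diff3_inj p q : d3a p q = 0 -> d3c q = 0 -> d3d q = 0 -> p = 0 /\ q = 0.
Proof.
move=> Ea Ec Ed.
have q0 : q = 0.
  have : x%:P * d3c q + y%:P * d3d q = 0 by rewrite Ec Ed !mulr0 addr0.
  rewrite diff3_cramer => /eqP; rewrite mulf_eq0 polyC_eq0 -oppr_eq0 opprB.
  by rewrite (negPf quadric_neq0) => /eqP.
split=> //; move/eqP: Ea; rewrite q0 diff3a_p0 oppr_eq0 mulf_eq0.
by rewrite (negPf (linear_poly_neq0 _ (mpolyX_neq0 _ _))) => /eqP.
Qed.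

End Exactness.

(** * From vectors of polynomials in [u] to matrices *)

Section Lin1Fun.
Variables (R : comNzRingType) (m n : nat) (D : 'rV[R]_m -> 'rV[R]_n).

Lemma mul_rV_lin1_fun :
  (forall s u v, D (s *: u + v) = s *: D u + D v) ->
  forall u, u *m lin1_mx D = D u.
Proof.
move=> DL u; pose iD := GRing.isLinear.Build R 'rV_m 'rV_n _ D DL.
pose D' : {linear 'rV[R]_m -> 'rV[R]_n} := HB.pack D iD.
exact: (mul_rV_lin1 D').
Qed.

Lemma map_lin1_eq0 (R' : comNzRingType) (phi : {rmorphism R -> R'}) :
  (forall u, map_mx phi (D u) = 0) -> map_mx phi (lin1_mx D) = 0.
Proof.
move=> H; apply/matrixP => i j; rewrite 2!mxE.
by have /rowP/(_ j) := H (delta_mx 0 i); rewrite !mxE.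
Qed.

End Lin1Fun.

Lemma lin1_exact (R : comNzRingType) m n p (D : 'rV[R]_m -> 'rV[R]_n)
    (D' : 'rV[R]_n -> 'rV[R]_p) :
  (forall s u v, D (s *: u + v) = s *: D u + D v) ->
  (forall s u v, D' (s *: u + v) = s *: D' u + D' v) ->
  (forall u, D' (D u) = 0) -> (forall v, D' v = 0 -> exists u, v = D u) ->
  forall v : 'rV_n, v *m lin1_mx D' = 0 <-> exists u : 'rV_m, v = u *m lin1_mx D.
Proof.
move=> DL DL' DD ex v; rewrite (mul_rV_lin1_fun DL').
split=> [/ex|] [u ->]; last by rewrite (mul_rV_lin1_fun DL) DD.
by exists u; rewrite (mul_rV_lin1_fun DL).
Qed.

Section RowComplex.
Variables (R : comNzRingType) (k : nat) (x y z t e : R).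
Implicit Types (r s : R) (f g a b c d p q : {poly R}).

Definition row1 r f g : 'rV[R]_(1 + (k.+2 + k.+1)) :=
  row_mx r%:M (row_mx (poly_rV f) (poly_rV g)).
Definition row2 a b c d : 'rV[R]_((k.+1 + k.+1) + (k.+1 + k.+1)) :=
  row_mx (row_mx (poly_rV a) (poly_rV b)) (row_mx (poly_rV c) (poly_rV d)).
Definition row3 p q : 'rV[R]_(k + k.+1) := row_mx (poly_rV p) (poly_rV q).

Lemma row1_surj v : exists r f g, [/\ (size f <= k.+2)%N, (size g <= k.+1)%N &
  v = row1 r f g].
Proof.
exists (lsubmx v 0 0), (rVpoly (lsubmx (rsubmx v))), (rVpoly (rsubmx (rsubmx v))).
split; try exact: size_poly.
by rewrite /row1 -mx11_scalar !rVpolyK !hsubmxK.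
Qed.

Lemma row2_surj v : exists a b c d, [/\ (size a <= k.+1)%N, (size b <= k.+1)%N,
  (size c <= k.+1)%N, (size d <= k.+1)%N & v = row2 a b c d].
Proof.
exists (rVpoly (lsubmx (lsubmx v))), (rVpoly (rsubmx (lsubmx v))),
  (rVpoly (lsubmx (rsubmx v))), (rVpoly (rsubmx (rsubmx v))).
split; try exact: size_poly.
by rewrite /row2 !rVpolyK !hsubmxK.
Qed.

Lemma row3_surj v : exists p q, [/\ (size p <= k)%N, (size q <= k.+1)%N & v = row3 p q].
Proof.
exists (rVpoly (lsubmx v)), (rVpoly (rsubmx v)).
split; try exact: size_poly.
by rewrite /row3 !rVpolyK !hsubmxK.
Qed.

Definition D1 (v : 'rV[R]_(1 + (k.+2 + k.+1))) : 'rV[R]_1 :=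
  (diff1 k x y z t e (lsubmx v 0 0) (rVpoly (lsubmx (rsubmx v)))
     (rVpoly (rsubmx (rsubmx v))))%:M.

Definition D2 (v : 'rV[R]_((k.+1 + k.+1) + (k.+1 + k.+1))) :=
  let a := rVpoly (lsubmx (lsubmx v)) in let b := rVpoly (rsubmx (lsubmx v)) in
  let c := rVpoly (lsubmx (rsubmx v)) in let d := rVpoly (rsubmx (rsubmx v)) in
  row1 (diff2r k x y z t e a b c d) (diff2f k x y z t a b c d) (diff2g k x y z t e c d).

Definition D3 (v : 'rV[R]_(k + k.+1)) :=
  let p := rVpoly (lsubmx v) in let q := rVpoly (rsubmx v) in
  row2 (diff3a k y z t p q) (diff3b k x y z p q) (diff3c k y t e q) (diff3d k x z e q).

Lemma D1_row1 r f g : (size f <= k.+2)%N -> (size g <= k.+1)%N ->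
  D1 (row1 r f g) = (diff1 k x y z t e r f g)%:M.
Proof.
by move=> Hf Hg; rewrite /D1 /row1 !(row_mxKl, row_mxKr) !poly_rV_K // mxE eqxx.
Qed.

Lemma D2_row2 a b c d : (size a <= k.+1)%N -> (size b <= k.+1)%N ->
  (size c <= k.+1)%N -> (size d <= k.+1)%N ->
  D2 (row2 a b c d) =
  row1 (diff2r k x y z t e a b c d) (diff2f k x y z t a b c d) (diff2g k x y z t e c d).
Proof.
by move=> Ha Hb Hc Hd; rewrite /D2 /row2 !(row_mxKl, row_mxKr) !poly_rV_K.
Qed.

Lemma D3_row3 p q : (size p <= k)%N -> (size q <= k.+1)%N ->
  D3 (row3 p q) =
  row2 (diff3a k y z t p q) (diff3b k x y z p q) (diff3c k y t e q) (diff3d k x z e q).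
Proof. by move=> Hp Hq; rewrite /D3 /row3 row_mxKl row_mxKr !poly_rV_K. Qed.

Lemma row1_linear s r f g r' f' g' :
  row1 (s * r + r') (s%:P * f + f') (s%:P * g + g') =
  s *: row1 r f g + row1 r' f' g'.
Proof.
rewrite /row1 !scale_row_mx !add_row_mx !mul_polyC !linearP scale_scalar_mx.
by rewrite raddfD.
Qed.

Lemma row2_linear s a b c d a' b' c' d' :
  row2 (s%:P * a + a') (s%:P * b + b') (s%:P * c + c') (s%:P * d + d') =
  s *: row2 a b c d + row2 a' b' c' d'.
Proof. by rewrite /row2 !scale_row_mx !add_row_mx !mul_polyC !linearP. Qed.

Lemma D1_linear s u v : D1 (s *: u + v) = s *: D1 u + D1 v.
Proof.
rewrite /D1 !linearP /= !mxE -!mul_polyC diff1D diff1CM raddfD /= -scale_scalar_mx.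
by [].
Qed.

Lemma D2_linear s u v : D2 (s *: u + v) = s *: D2 u + D2 v.
Proof.
rewrite /D2 !linearP /= -!mul_polyC diff2rD diff2rCM diff2fD diff2fCM.
by rewrite diff2gD diff2gCM row1_linear.
Qed.

Lemma D3_linear s u v : D3 (s *: u + v) = s *: D3 u + D3 v.
Proof.
rewrite /D3 !linearP /= -!mul_polyC diff3aD diff3aCM diff3bD diff3bCM.
rewrite diff3cD diff3cCM diff3dD diff3dCM.
by rewrite row2_linear.
Qed.

Lemma row1_0 : row1 0 0 0 = 0.
Proof. by rewrite /row1 !linear0 raddf0 !row_mx0. Qed.

Lemma row_mx_eq0 m n (A : 'rV[R]_m) (B : 'rV[R]_n) : row_mx A B = 0 -> A = 0 /\ B = 0.
Proof. by rewrite -[RHS]row_mx0 => /eq_row_mx. Qed.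

Lemma row1_eq0 r f g : (size f <= k.+2)%N -> (size g <= k.+1)%N ->
  row1 r f g = 0 -> [/\ r = 0, f = 0 & g = 0].
Proof.
move=> Hf Hg /row_mx_eq0 [Er /row_mx_eq0 [Ef Eg]]; split.
- by move/matrixP/(_ 0 0): Er; rewrite !mxE eqxx.
- by rewrite -(poly_rV_K Hf) Ef linear0.
- by rewrite -(poly_rV_K Hg) Eg linear0.
Qed.

Lemma row2_eq0 a b c d : (size a <= k.+1)%N -> (size b <= k.+1)%N ->
  (size c <= k.+1)%N -> (size d <= k.+1)%N ->
  row2 a b c d = 0 -> [/\ a = 0, b = 0, c = 0 & d = 0].
Proof.
move=> Ha Hb Hc Hd /row_mx_eq0 [/row_mx_eq0 [Ea Eb] /row_mx_eq0 [Ec Ed]]; split.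
- by rewrite -(poly_rV_K Ha) Ea linear0.
- by rewrite -(poly_rV_K Hb) Eb linear0.
- by rewrite -(poly_rV_K Hc) Ec linear0.
- by rewrite -(poly_rV_K Hd) Ed linear0.
Qed.

Section Minimal.
Variables (R' : comNzRingType) (phi : {rmorphism R -> R'}).
Hypotheses (x0 : phi x = 0) (y0 : phi y = 0) (z0 : phi z = 0) (t0 : phi t = 0)
  (e0 : phi e = 0).

Lemma D1_minimal u : map_mx phi (D1 u) = 0.
Proof.
rewrite /D1 map_scalar_mx map_diff1 x0 y0 z0 t0 e0 diff1_at0.
exact: raddf0.
Qed.

Lemma D2_minimal u : (0 < k)%N -> map_mx phi (D2 u) = 0.
Proof.
move=> k0; rewrite /D2 /row1 !map_row_mx map_scalar_mx !map_poly_rV.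
rewrite map_diff2r map_diff2f map_diff2g x0 y0 z0 t0 e0.
by rewrite diff2r_at0 // diff2f_at0 diff2g_at0 !linear0 raddf0 !row_mx0.
Qed.

Lemma D3_minimal u : map_mx phi (D3 u) = 0.
Proof.
rewrite /D3 /row2 !map_row_mx !map_poly_rV.
rewrite map_diff3a map_diff3b map_diff3c map_diff3d x0 y0 z0 t0 e0.
by rewrite diff3a_at0 diff3b_at0 diff3c_at0 diff3d_at0 !linear0 !row_mx0.
Qed.

End Minimal.

End RowComplex.

(** * The Betti sequence of [S / J_eps] *)

Section Betti.
Variables (K : fieldType) (k : nat) (eps : K).
Local Notation S := {mpoly K[4]}.
Local Notation x := ('X_X0 : S).
Local Notation y := ('X_X1 : S).
Local Notation z := ('X_X2 : S).
Local Notation t := ('X_X3 : S).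
Local Notation epsx := (eps%:MP * x : S).

(* For [eps = 1] this is the ideal of the semigroup ring, for [eps = 0] the
   ideal of its tangent cone. *)
Definition ideal_J (p : S) : Prop := exists (r : S) (f g : {poly S}),
  [/\ (size f <= k.+2)%N, (size g <= k.+1)%N & p = diff1 k x y z t epsx r f g].

Lemma betti_sequence_of_J (I : S -> Prop) : (0 < k)%N ->
  (forall p, I p <-> ideal_J p) ->
  betti_sequence I [:: 1%N; 1 + (k.+2 + k.+1); k.+1 + k.+1 + (k.+1 + k.+1); k + k.+1]%N.
Proof.
move=> k0 IJ.
have D1L := @D1_linear S k x y z t epsx.
have D2L := @D2_linear S k x y z t epsx.
have D3L := @D3_linear S k x y z t epsx.
have c0 j : mcoeff 0%MM ('X_j : S) = 0.
  by rewrite mcoeffX; case: eqP => // /(congr1 (@mdeg 4)); rewrite mdeg1 mdeg0.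
have c0e : mcoeff 0%MM epsx = 0 by rewrite rmorphM /= c0 mulr0.
apply: (@minimal_betti_sequence _ _ I _ _ _ (lin1_mx (@D1 S k x y z t epsx))
  (lin1_mx (@D2 S k x y z t epsx)) (lin1_mx (@D3 S k x y z t epsx))).
- move=> p; rewrite IJ; split=> [[r [f [g [Hf Hg ->]]]]|[u ->]].
    exists (row1 k r f g); rewrite (mul_rV_lin1_fun D1L) (D1_row1 _ _ _ _ _ _ Hf Hg).
    by rewrite mxE eqxx.
  rewrite (mul_rV_lin1_fun D1L); have [r [f [g [Hf Hg ->]]]] := row1_surj u.
  by exists r, f, g; split=> //; rewrite (D1_row1 _ _ _ _ _ _ Hf Hg) mxE eqxx.
- apply: (lin1_exact D2L D1L) => [u|v].
    have [a [b [c [d [Ha Hb Hc Hd ->]]]]] := row2_surj u.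
    rewrite (D2_row2 _ _ _ _ _ Ha Hb Hc Hd).
    rewrite (D1_row1 _ _ _ _ _ _ (size_diff2f _ _ _ _ _ _ Ha Hb) (size_diff2g _ _ _ _ _ Hc Hd)).
    by rewrite (diff1_diff2 _ _ _ _ _ Ha Hb Hc Hd) raddf0.
  have [r [f [g [Hf Hg ->]]]] := row1_surj v.
  rewrite (D1_row1 _ _ _ _ _ _ Hf Hg) => /matrixP/(_ 0 0); rewrite !mxE eqxx mulr1n.
  case/(diff1_exact Hf Hg) => a [b [c [d [[Ha Hb Hc Hd] -> -> ->]]]].
  by exists (row2 k a b c d); rewrite (D2_row2 _ _ _ _ _ Ha Hb Hc Hd).
- apply: (lin1_exact D3L D2L) => [u|v].
    have [p [q [Hp Hq ->]]] := row3_surj u.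
    have Ha := size_diff3a y z t q Hp; have Hb := size_diff3b x y z q Hp.
    have Hc := size_diff3c y t epsx Hq; have Hd := size_diff3d x z epsx Hq.
    by rewrite (D3_row3 _ _ _ _ _ Hp Hq) (D2_row2 _ _ _ _ _ Ha Hb Hc Hd)
      diff2f_diff3 diff2g_diff3 (diff2r_diff3 eps Hp Hq) row1_0.
  have [a [b [c [d [Ha Hb Hc Hd ->]]]]] := row2_surj v.
  rewrite (D2_row2 _ _ _ _ _ Ha Hb Hc Hd) => /row1_eq0 []; [exact: size_diff2f|exact: size_diff2g|].
  move=> _ /(diff2_exact Ha Hb Hc Hd)/[apply] -[p [q [Hp Hq [-> -> -> ->]]]].
  by exists (row3 k p q); rewrite (D3_row3 _ _ _ _ _ Hp Hq).
- move=> v; rewrite (mul_rV_lin1_fun D3L).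
  have [p [q [Hp Hq ->]]] := row3_surj v.
  rewrite (D3_row3 _ _ _ _ _ Hp Hq) => /row2_eq0.
  case; [exact: size_diff3a|exact: size_diff3b|exact: size_diff3c|exact: size_diff3d|].
  by move=> Ea _ Ec Ed; have [-> ->] := diff3_inj Ea Ec Ed; rewrite /row3 !linear0 row_mx0.
- apply: map_lin1_eq0 => u.
  by apply: D1_minimal; first [exact: c0 | exact: c0e | exact: k0].
- apply: map_lin1_eq0 => u.
  by apply: D2_minimal; first [exact: c0 | exact: c0e | exact: k0].
- apply: map_lin1_eq0 => u.
  by apply: D3_minimal; first [exact: c0 | exact: c0e | exact: k0].
- by rewrite addnS.
Qed.

End Betti.

(** * The weight grading of the semigroup ideal *)

Section SemigroupIdeal.
Variables (K : fieldType) (n : nat) (b : n.-tuple nat).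
Local Notation S := {mpoly K[n]}.
Implicit Types (p q : S) (m : 'X_{1..n}).

Definition weight m := (\sum_i m i * tnth b i)%N.

Lemma weightD m m' : weight (m + m') = (weight m + weight m')%N.
Proof. by rewrite -big_split; apply: eq_bigr => i _; rewrite mnmDE mulnDl. Qed.

Lemma mmap1_weight m : mmap1 (fun i => 'X^(tnth b i)) m = 'X^(weight m) :> {poly K}.
Proof.
rewrite /mmap1 /weight; elim/big_rec2: _ => [|i w q _ ->]; first by rewrite expr0.
by rewrite exprD -exprM mulnC.
Qed.

Lemma semigroup_idealD p q :
  semigroup_ideal b p -> semigroup_ideal b q -> semigroup_ideal b (p + q).
Proof. by rewrite /semigroup_ideal mmapD => -> ->; rewrite addr0. Qed.

Lemma semigroup_idealM p q : semigroup_ideal b q -> semigroup_ideal b (p * q).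
Proof. by rewrite /semigroup_ideal rmorphM /= => ->; rewrite mulr0. Qed.

Lemma semigroup_ideal_binomial m m' : weight m = weight m' ->
  semigroup_ideal b ('X_[K, m] - 'X_[m']).
Proof. by move=> E; rewrite /semigroup_ideal mmapB !mmapX !mmap1_weight E subrr. Qed.

(** The sum is the coefficient of [s^w] in the image of [p], as each monomial maps to the power of
    [s] given by its weight. *)
Lemma semigroup_ideal_weight p : semigroup_ideal b p ->
  forall w, \sum_(m <- msupp p | weight m == w) p@_m = 0.
Proof.
move=> Ip w; have := congr1 (fun q : {poly K} => q`_w) Ip.
rewrite /mmap coef_sum coef0 => E; rewrite -[RHS]E big_mkcond; apply: eq_bigr => m _.
rewrite mmap1_weight coefCM coefXn eq_sym.
by case: eqP; rewrite ?mulr1 ?mulr0.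
Qed.

End SemigroupIdeal.

(** * Initial forms of binomials *)

Section InitialIdeal.
Variables (K : fieldType) (n : nat).
Local Notation S := {mpoly K[n]}.
Implicit Types (p q : S) (m : 'X_{1..n}) (I : S -> Prop).

Lemma bigmin_geq (T : eqType) (s : seq T) (F : T -> nat) x0 c :
  (forall i, i \in s -> c <= F i)%N -> (c <= x0)%N ->
  (c <= \big[minn/x0]_(i <- s) F i)%N.
Proof.
move=> Hs H0; rewrite big_seq; elim/big_ind: _ => // x y Hx Hy.
by rewrite leq_min Hx.
Qed.

Lemma bigmin_leq (T : eqType) (s : seq T) (F : T -> nat) x0 i :
  i \in s -> (\big[minn/x0]_(j <- s) F j <= F i)%N.
Proof.
elim: s => // j s IH; rewrite inE big_cons => /predU1P[->|Hi]; first exact: geq_minl.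
by rewrite (leq_trans (geq_minr _ _)) // IH.
Qed.

Lemma mindeg_leq p m : m \in msupp p -> (mindeg p <= mdeg m)%N.
Proof. exact: bigmin_leq. Qed.

Lemma msupp_binomial m m' m0 : m0 \in msupp ('X_[K, m] - 'X_[m']) -> (m0 == m) || (m0 == m').
Proof.
rewrite mcoeff_msupp mcoeffB !mcoeffX ![_ == m0]eq_sym.
by case: (m0 == m) => //=; case: (m0 == m') => //=; rewrite subr0 eqxx.
Qed.

Lemma binomial_neq0 m m' : m != m' -> 'X_[K, m] - 'X_[m'] != 0.
Proof.
move=> ne; apply/eqP => /(congr1 (mcoeff m)).
rewrite mcoeffB !mcoeffX eqxx eq_sym (negPf ne) subr0 mcoeff0 => /eqP.
by rewrite oner_eq0.
Qed.

(** The power of 0 is 1 in equal degrees and 0 otherwise, so the second term is kept exactly when it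
    has least degree. In this form the result is the binomial of [J_eps] at [eps = 0]. *)
Lemma initial_form_binomial m m' : m != m' -> (mdeg m <= mdeg m')%N ->
  initial_form ('X_[K, m] - 'X_[m']) = 'X_[m] - 0 ^+ (mdeg m' - mdeg m) *: 'X_[m'].
Proof.
move=> ne le; rewrite /initial_form.
have supp : m \in msupp ('X_[K, m] - 'X_[m']).
  by rewrite mcoeff_msupp mcoeffB !mcoeffX eqxx [m' == m]eq_sym (negPf ne) subr0 oner_eq0.
have -> : mindeg ('X_[K, m] - 'X_[m']) = mdeg m.
  apply/eqP; rewrite eqn_leq mindeg_leq //=.
  apply: bigmin_geq => [i /msupp_binomial /orP[] /eqP -> //|].
  exact/ltnW/msize_mdeg_lt.
rewrite pihomogB !pihomogX eqxx; congr (_ - _).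
move: le; rewrite leq_eqVlt => /predU1P[->|lt].
  by rewrite eqxx subnn expr0 scale1r.
by rewrite gtn_eqF // expr0n subn_eq0 leqNgt lt scale0r.
Qed.

Lemma initial_idealD I p q :
  initial_ideal I p -> initial_ideal I q -> initial_ideal I (p + q).
Proof.
move=> [s Hs ->] [s' Hs' ->]; exists (s ++ s'); last by rewrite big_cat.
by move=> x; rewrite mem_cat => /orP[/Hs|/Hs'].
Qed.

Lemma initial_ideal0 I : initial_ideal I 0.
Proof. by exists [::]; rewrite ?big_nil. Qed.

Lemma initial_idealM I p q : I q -> q != 0 -> initial_ideal I (p * initial_form q).
Proof.
move=> Iq q0; exists [:: (p, q)]; last by rewrite big_seq1.
by move=> x; rewrite inE => /eqP ->.
Qed.

End InitialIdeal.

(** * Rewriting to standard monomials *)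

Section Weights.
Variable k : nat.
Local Notation h := k.+1.
Implicit Types (m : 'X_{1..4}).

Definition mon (a b c d : nat) : 'X_{1..4} := [multinom [tuple a; b; c; d]].

Lemma mon_eta m : m = mon (m X0) (m X1) (m X2) (m X3).
Proof. by apply/mnmP; elim/ord4_ind. Qed.

Lemma mdeg_mon a b c d : mdeg (mon a b c d) = (a + b + c + d)%N.
Proof. by rewrite mdegE !big_ord_recl big_ord0 /= addn0 !addnA. Qed.

Lemma monD a b c d a' b' c' d' :
  (mon a b c d + mon a' b' c' d')%MM = mon (a + a') (b + b') (c + c') (d + d').
Proof. by apply/mnmP; elim/ord4_ind; rewrite mnmDE. Qed.

(** Each generator is [h (h+1)], plus [h+1] for [z] and [t], plus 1 for [y] and [t]. When
    [b + d <= h] and [c + d < h], these two sums are the digits of the weight in mixed radix. *)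
Lemma weight_mon a b c d : weight (A_gens h) (mon a b c d) =
  ((h + 1) * (h * (a + b + c + d) + (c + d)) + (b + d))%N.
Proof.
rewrite /weight !big_ord_recl big_ord0 /= /A_gens !(tnth_nth 0%N) /=.
ring.
Qed.

End Weights.

Section Standard.
Variables (K : fieldType) (k : nat).
Local Notation S := {mpoly K[4]}.
Local Notation h := k.+1.
Local Notation x := ('X_X0 : S).
Local Notation y := ('X_X1 : S).
Local Notation z := ('X_X2 : S).
Local Notation t := ('X_X3 : S).
Local Notation J := (ideal_J k).
Local Notation d1 eps := (diff1 k x y z t (eps%:MP * x : S)).
Local Notation wt := (weight (A_gens h)).
Implicit Types (m : 'X_{1..4}) (p q : S) (eps : K).

Lemma ideal_J0 eps : J eps 0.
Proof.
exists 0, 0, 0; rewrite !size_poly0; split=> //.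
by rewrite /diff1 !homeval0 !mulr0 mul0r subrr !addr0.
Qed.

Lemma ideal_JD eps p q : J eps p -> J eps q -> J eps (p + q).
Proof.
move=> [r [f [g [Hf Hg ->]]]] [r' [f' [g' [Hf' Hg' ->]]]].
by exists (r + r'), (f + f'), (g + g'); rewrite diff1D; split; [exact: le_sizeD..|].
Qed.

Lemma ideal_JM eps p q : J eps q -> J eps (p * q).
Proof.
move=> [r [f [g [Hf Hg ->]]]].
exists (p * r), (p%:P * f), (p%:P * g); rewrite diff1CM.
by split; [exact: le_sizeC..|].
Qed.

Lemma ideal_JZ eps c q : J eps q -> J eps (c *: q).
Proof. by rewrite -mul_mpolyC; exact: ideal_JM. Qed.

Lemma ideal_J_sum eps (T : Type) (s : seq T) (P : pred T) (F : T -> S) :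
  (forall i, P i -> J eps (F i)) -> J eps (\sum_(i <- s | P i) F i).
Proof. by move=> H; elim/big_ind: _ => //; [exact: ideal_J0 | exact: ideal_JD]. Qed.

Lemma mpolyX_mon a b c d : 'X_[mon a b c d] = x ^+ a * y ^+ b * z ^+ c * t ^+ d :> S.
Proof.
rewrite mpolyXE_id !big_ord_recl big_ord0 mulr1 !mulrA.
by congr ('X_ _ ^+ _ * 'X_ _ ^+ _ * 'X_ _ ^+ _ * 'X_ _ ^+ _); apply: val_inj.
Qed.

Lemma homeval_Xn d i (v w : S) : (i <= d)%N -> homeval d 'X^i v w = v ^+ (d - i) * w ^+ i.
Proof.
move=> Hi; rewrite /homeval (bigD1 (Ordinal (Hi : (i < d.+1)%N))) //= coefXn eqxx mul1r.
rewrite big1 ?addr0 // => j; rewrite -val_eqE /= => /negPf ne.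
by rewrite coefXn ne !mul0r.
Qed.

Lemma diff1_quadric eps : d1 eps 1 0 0 = 'X_[mon 0 1 1 0] - 'X_[mon 1 0 0 1].
Proof. by rewrite /diff1 !homeval0 !mpolyX_mon; ring. Qed.

Lemma diff1_F eps i : (i <= h)%N -> d1 eps 0 'X^i 0 =
  'X_[mon 0 0 (h - i) i] - eps *: 'X_[mon (h - i).+1 i 0 0].
Proof.
move=> Hi; rewrite /diff1 !homeval0 !homeval_Xn // !mpolyX_mon -mul_mpolyC !exprS.
ring.
Qed.

Lemma diff1_G eps i : (i <= k)%N -> d1 eps 0 0 'X^i =
  'X_[mon 0 (k - i).+2 0 i] - 'X_[mon (k - i).+1 0 i.+1 0].
Proof.
by move=> Hi; rewrite /diff1 !homeval0 !homeval_Xn // !mpolyX_mon !exprS; ring.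
Qed.

(** The quantifier over [eps] is inside, so that one chain of reductions serves both the semigroup
    ideal and the initial ideal. *)
Definition rewrites m m' := [/\ wt m = wt m', (mdeg m <= mdeg m')%N &
  forall eps, J eps ('X_[m] - eps ^+ (mdeg m' - mdeg m) *: 'X_[m'])].

Lemma rewrites_refl m : rewrites m m.
Proof. by split=> // eps; rewrite subnn expr0 scale1r subrr; exact: ideal_J0. Qed.

Lemma rewrites_trans m m' m'' : rewrites m m' -> rewrites m' m'' -> rewrites m m''.
Proof.
move=> [w1 le1 J1] [w2 le2 J2]; split; [by rewrite w1 | exact: leq_trans le2 |] => eps.
have -> : (mdeg m'' - mdeg m = (mdeg m' - mdeg m) + (mdeg m'' - mdeg m'))%N by lia.
rewrite exprD -scalerA -(subrK (eps ^+ (mdeg m' - mdeg m) *: 'X_[m']) 'X_[m]) -addrA.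
by rewrite -scalerBr; apply: ideal_JD => //; apply: ideal_JZ.
Qed.

Lemma rewrites_mul m0 m m' : rewrites m m' -> rewrites (m0 + m) (m0 + m').
Proof.
move=> [w1 le1 J1]; split; first by rewrite !weightD w1.
  by rewrite !mdegD leq_add2l.
move=> eps; rewrite !mdegD subnDl !mpolyXD scalerAr -mulrBr.
exact: ideal_JM.
Qed.

Lemma rewrites_quadric a b c d : rewrites (mon a b.+1 c.+1 d) (mon a.+1 b c d.+1).
Proof.
have -> : mon a b.+1 c.+1 d = (mon a b c d + mon 0 1 1 0)%MM by rewrite monD !addn0 !addn1.
have -> : mon a.+1 b c d.+1 = (mon a b c d + mon 1 0 0 1)%MM by rewrite monD !addn0 !addn1.
apply: rewrites_mul; split; rewrite ?weight_mon ?mdeg_mon; [lia | lia |] => eps.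
rewrite subnn expr0 scale1r -(diff1_quadric eps).
by exists 1, 0, 0; rewrite !size_poly0.
Qed.

Lemma rewrites_F i a b c d a' b' c' d' : (i <= h)%N ->
  a' = (a + (h - i).+1)%N -> b' = (b + i)%N -> c = (c' + (h - i))%N -> d = (d' + i)%N ->
  rewrites (mon a b c d) (mon a' b' c' d').
Proof.
move=> Hi -> -> -> ->.
rewrite -{1}[a]addn0 -{1}[b]addn0 -{2}[c']addn0 -{2}[d']addn0 -!monD.
apply: rewrites_mul; split; rewrite ?weight_mon ?mdeg_mon; [| lia |] => [|eps].
  rewrite (_ : (0 + 0 + (h - i) + i = h)%N); last by lia.
  rewrite (_ : ((h - i).+1 + i + 0 + 0 = h + 1)%N); last by lia.
  ring.
rewrite (_ : (_ + _ - _ = 1)%N); last by lia.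
rewrite expr1 -(diff1_F eps Hi); exists 0, 'X^i, 0.
by rewrite size_polyXn size_poly0.
Qed.

Lemma rewrites_G i a b c d a' b' c' d' : (i <= k)%N ->
  a' = (a + (k - i).+1)%N -> b = (b' + (k - i).+2)%N -> c' = (c + i.+1)%N -> d = (d' + i)%N ->
  rewrites (mon a b c d) (mon a' b' c' d').
Proof.
move=> Hi -> -> -> ->.
rewrite -{1}[a]addn0 -{1}[c]addn0 -{2}[b']addn0 -{2}[d']addn0 -!monD.
apply: rewrites_mul; split; rewrite ?weight_mon ?mdeg_mon; [| lia |] => [|eps].
  rewrite (_ : (0 + (k - i).+2 + 0 + i = k + 2)%N); last by lia.
  rewrite (_ : ((k - i).+1 + 0 + i.+1 + 0 = k + 2)%N); last by lia.
  rewrite (_ : ((k - i).+2 + i = k + 2)%N); last by lia.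
  ring.
rewrite (_ : (_ + _ - _ = 0)%N); last by lia.
rewrite expr0 scale1r -(diff1_G eps Hi); exists 0, 0, 'X^i.
by rewrite size_polyXn size_poly0.
Qed.

(** The exponents of [y], [z], [t] in monomials divisible by none of [y z], [z^(h-i) t^i] for
    [i <= h], and [y^(h+1-i) t^i] for [i <= k], the first terms of the generators; the exponent of
    [x] is free. *)
Definition standard b c d :=
  [&& c == 0%N, d <= k & b + d <= h]%N || [&& b == 0%N, 0 < c & c + d <= k]%N.

Definition reducible a b c d := exists a' b' c' d',
  standard b' c' d' /\ rewrites (mon a b c d) (mon a' b' c' d').

Lemma standard_reducible a b c d : standard b c d -> reducible a b c d.
Proof. by exists a, b, c, d; split=> //; exact: rewrites_refl. Qed.

Lemma reducible_trans a b c d a' b' c' d' :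
  rewrites (mon a b c d) (mon a' b' c' d') -> reducible a' b' c' d' -> reducible a b c d.
Proof.
move=> H [a0 [b0 [c0 [d0 [H1 H2]]]]]; exists a0, b0, c0, d0; split=> //.
exact: rewrites_trans H2.
Qed.

Lemma reducible_zh a : reducible a 0 h 0.
Proof.
apply: (@reducible_trans _ _ _ _ (a + h.+1)%N 0 0 0).
  by apply: (@rewrites_F 0); lia.
by apply: standard_reducible; rewrite /standard; lia.
Qed.

Lemma reducible_y a b c d : standard b c d -> reducible a b.+1 c d.
Proof.
case/orP=> /and3P [] => [/eqP-> Hd Hb|/eqP-> Hc Hd].
  case: (leqP (b.+1 + d) h) => H.
    by apply: standard_reducible; rewrite /standard; lia.
  (* Here [b + d = h], so the [y]-[t] part is exactly the first term of [G_d]. *)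
  apply: (@reducible_trans _ _ _ _ (a + (k - d).+1)%N 0 d.+1 0).
    by apply: (@rewrites_G d); lia.
  case: (ltnP d k) => Hdk; last by rewrite (_ : d = k); [exact: reducible_zh | lia].
  by apply: standard_reducible; rewrite /standard; lia.
case: c Hc Hd => // c _ Hd.
apply: reducible_trans (rewrites_quadric _ _ _ _) _.
by apply: standard_reducible; rewrite /standard; case: c Hd => [|c] Hd; lia.
Qed.

Lemma reducible_z a b c d : standard b c d -> reducible a b c.+1 d.
Proof.
case/orP=> /and3P [] => [/eqP-> Hd Hb|/eqP-> Hc Hd].
  case: b Hb => [|b] Hb.
    case: (ltnP d k) => Hdk; first by apply: standard_reducible; rewrite /standard; lia.
    apply: (@reducible_trans _ _ _ _ a.+2 k 0 0).
      by apply: (@rewrites_F k); lia.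
    by apply: standard_reducible; rewrite /standard; lia.
  apply: reducible_trans (rewrites_quadric _ _ _ _) _.
  case: (ltnP d k) => Hdk; first by apply: standard_reducible; rewrite /standard; lia.
  apply: (@reducible_trans _ _ _ _ a.+2 (b + h)%N 0 0).
    by apply: (@rewrites_F h); lia.
  by apply: standard_reducible; rewrite /standard; lia.
case: (leqP (c.+1 + d) k) => H; first by apply: standard_reducible; rewrite /standard; lia.
apply: (@reducible_trans _ _ _ _ (a + (h - d).+1)%N d 0 0).
  by apply: (@rewrites_F d); lia.
by apply: standard_reducible; rewrite /standard; lia.
Qed.

Lemma reducible_t a b c d : (0 < k)%N -> standard b c d -> reducible a b c d.+1.
Proof.
move=> k0; case/orP=> /and3P [] => [/eqP-> Hd Hb|/eqP-> Hc Hd].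
  case: (ltnP d k) => Hdk; last first.
    apply: (@reducible_trans _ _ _ _ a.+1 (b + h)%N 0 0).
      by apply: (@rewrites_F h); lia.
    (* Here [b <= 1]. For [b = 1] the monomial [y^(h+1)] becomes [x^h z] by [G_0], and [z] is
       standard because [k > 0]. *)
    case: (posnP b) => Hb0; first by apply: standard_reducible; rewrite /standard; lia.
    apply: (@reducible_trans _ _ _ _ (a.+1 + h)%N 0 1 0).
      by apply: (@rewrites_G 0); lia.
    by apply: standard_reducible; rewrite /standard; lia.
  case: (leqP (b + d.+1) h) => H; first by apply: standard_reducible; rewrite /standard; lia.
  apply: (@reducible_trans _ _ _ _ (a + (k - d.+1).+1)%N 0 d.+2 0).
    by apply: (@rewrites_G d.+1); lia.
  case: (ltnP d.+1 k) => Hd1; first by apply: standard_reducible; rewrite /standard; lia.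
  by rewrite (_ : d.+2 = h); [exact: reducible_zh | lia].
case: (leqP (c + d.+1) k) => H; first by apply: standard_reducible; rewrite /standard; lia.
apply: (@reducible_trans _ _ _ _ (a + (h - d.+1).+1)%N d.+1 0 0).
  by apply: (@rewrites_F d.+1); lia.
by apply: standard_reducible; rewrite /standard; lia.
Qed.

(** Monomials are built one variable at a time: [rewrites] is stable under multiplication, so only a
    variable times a standard monomial has to be reduced. *)
Lemma reducible_all a b c d : (0 < k)%N -> reducible a b c d.
Proof.
move=> k0.
have step m0 (a1 b1 c1 d1 a2 b2 c2 d2 : nat) : reducible a1 b1 c1 d1 ->
    (forall a' b' c' d', standard b' c' d' ->
       exists a3 b3 c3 d3, reducible a3 b3 c3 d3 /\
         mon a3 b3 c3 d3 = (m0 + mon a' b' c' d')%MM) ->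
    mon a2 b2 c2 d2 = (m0 + mon a1 b1 c1 d1)%MM -> reducible a2 b2 c2 d2.
  move=> [a' [b' [c' [d' [Hs Hr]]]]] H E.
  have [a3 [b3 [c3 [d3 [H3 E3]]]]] := H a' b' c' d' Hs.
  apply: reducible_trans H3; rewrite E E3; exact: rewrites_mul.
elim: d => [|d IHd].
  elim: c => [|c IHc].
    elim: b => [|b IHb]; first exact: standard_reducible.
    apply: (step (mon 0 1 0 0) _ _ _ _ _ _ _ _ IHb); last by rewrite monD.
    move=> a' b' c' d' Hs; exists a', b'.+1, c', d'.
    by rewrite monD; split=> //; exact: reducible_y.
  apply: (step (mon 0 0 1 0) _ _ _ _ _ _ _ _ IHc); last by rewrite monD.
  move=> a' b' c' d' Hs; exists a', b', c'.+1, d'.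
  by rewrite monD; split=> //; exact: reducible_z.
apply: (step (mon 0 0 0 1) _ _ _ _ _ _ _ _ IHd); last by rewrite monD.
move=> a' b' c' d' Hs; exists a', b', c', d'.+1.
by rewrite monD; split=> //; exact: reducible_t.
Qed.

Definition standard_mon m := standard (m X1) (m X2) (m X3).

Lemma standard_exists m : (0 < k)%N -> exists2 m', standard_mon m' & rewrites m m'.
Proof.
move=> k0; have [a [b [c [d [H1 H2]]]]] := reducible_all (m X0) (m X1) (m X2) (m X3) k0.
by exists (mon a b c d); rewrite // [m]mon_eta.
Qed.

Lemma divmod_uniq (q r q' r' n : nat) : (r < n)%N -> (r' < n)%N ->
  (n * q + r = n * q' + r')%N -> q = q' /\ r = r'.
Proof.
move=> Hr Hr' E; have n0 : (0 < n)%N by lia.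
have := congr1 (divn^~ n) E; have := congr1 (modn^~ n) E => /=.
rewrite ![(n * _)%N]mulnC !modnMDl !divnMDl // !modn_small // !divn_small //.
by rewrite !addn0.
Qed.

Lemma standard_uniq m m' :
  standard_mon m -> standard_mon m' -> wt m = wt m' -> m = m'.
Proof.
rewrite [m]mon_eta [m']mon_eta !weight_mon /standard_mon.
move: (m X0) (m X1) (m X2) (m X3) (m' X0) (m' X1) (m' X2) (m' X3).
move=> a b c d a' b' c' d' H H' E.
have {H}H : standard b c d := H; have {H'}H' : standard b' c' d' := H'.
rewrite /standard in H H'.
have [E1 E2] : ((h * (a + b + c + d) + (c + d)) = (h * (a' + b' + c' + d') + (c' + d')) /\
    b + d = b' + d')%N by apply: divmod_uniq E; lia.
have [E3 E4] : (a + b + c + d = a' + b' + c' + d' /\ c + d = c' + d')%N.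
  by apply: divmod_uniq E1; lia.
(* Given the degree, [b + d] and [c + d], the smaller of the two sums is [d]: standardness forces
   [b] or [c] to be zero. *)
by congr mon; lia.
Qed.

End Standard.

(** * Identification of the semigroup ideal and of its initial ideal *)

Section Identification.
Variables (K : fieldType) (k : nat).
Hypothesis k_gt0 : (0 < k)%N.
Local Notation S := {mpoly K[4]}.
Local Notation h := k.+1.
Local Notation x := ('X_X0 : S).
Local Notation y := ('X_X1 : S).
Local Notation z := ('X_X2 : S).
Local Notation t := ('X_X3 : S).
Local Notation J := (@ideal_J K k).
Local Notation d1 eps := (diff1 k x y z t (eps%:MP * x : S)).
Local Notation wt := (weight (A_gens h)).
Local Notation I_A := (@semigroup_ideal K 4 (A_gens h)).
Implicit Types (m : 'X_{1..4}) (p q : S) (eps : K).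

Lemma normal_exists m : exists m', standard_mon k m' && (wt m' == wt m).
Proof.
by have [m' H [-> _ _]] := standard_exists K m k_gt0; exists m'; rewrite H eqxx.
Qed.

Definition nf m := xchoose (normal_exists m).

(** Through this test, a coefficient of a combination of normal forms becomes a sum over one weight
    class, which [semigroup_ideal_weight] evaluates. *)
Lemma nf_eq m m' : (nf m == m') = standard_mon k m' && (wt m == wt m').
Proof.
have /andP [Hs /eqP Hw] : standard_mon k (nf m) && (wt (nf m) == wt m).
  exact: (xchooseP (normal_exists m)).
apply/eqP/andP => [<-|[Hs' /eqP Hw']]; first by rewrite Hw eqxx.
by apply: (standard_uniq Hs Hs'); rewrite Hw.
Qed.

Lemma nf_rewrites m : rewrites K k m (nf m).
Proof.
have [m' Hs Hr] := standard_exists K m k_gt0.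
suff /eqP -> : nf m == m' by [].
by rewrite nf_eq Hs /=; case: Hr => ->.
Qed.

Lemma ideal_J_nf eps (s : seq 'X_{1..4}) (P : pred 'X_{1..4}) (c : 'X_{1..4} -> K) :
  \sum_(m <- s | P m) c m *: (eps ^+ (mdeg (nf m) - mdeg m) *: 'X_[nf m]) = 0 :> S ->
  J eps (\sum_(m <- s | P m) c m *: 'X_[m]).
Proof.
move=> E; rewrite -[X in J eps X]subr0 -[X in J eps (_ - X)]E -sumrB; apply: ideal_J_sum => m _.
by rewrite -scalerBr; apply: ideal_JZ; case: (nf_rewrites m).
Qed.

Lemma semigroup_ideal_sub p : I_A p -> J 1 p.
Proof.
move=> Ip; rewrite [p]mpolyE; apply: ideal_J_nf; apply/mpolyP => n.
rewrite mcoeff0 raddf_sum /=.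
under eq_bigr do rewrite expr1n scale1r mcoeffZ mcoeffX mulr_natr mulrb nf_eq.
rewrite -big_mkcond /=; case: (standard_mon k n); last by rewrite big_pred0_eq.
exact: semigroup_ideal_weight Ip (wt n).
Qed.

(** At [eps = 0] only normal forms of the least degree [d] remain. If [n] is standard of degree [d],
    every monomial of [p] with the weight of [n] has degree at least [d] and rewrites to [n] without
    loss of degree, hence has degree [d]. So the whole weight class lies in the initial form, and
    its coefficients sum to zero. *)
Lemma initial_form_sub p : I_A p -> J 0 (initial_form p).
Proof.
move=> Ip; rewrite /initial_form pihomogE; set d := mindeg p.
apply: ideal_J_nf; apply/mpolyP => n; rewrite mcoeff0 raddf_sum /=.
have le_nf m : (mdeg m <= mdeg (nf m))%N by case: (nf_rewrites m).
have [Hn|/negPf Hn] := boolP (standard_mon k n && (mdeg n == d)); last first.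
  apply: big1 => m /eqP Hm; rewrite !mcoeffZ mcoeffX.
  case: eqP => [E|_]; last by rewrite !mulr0.
  have Hs : standard_mon k n by move/eqP: E; rewrite nf_eq => /andP [].
  move: Hn; rewrite Hs /= -E => Hn.
  rewrite expr0n subn_eq0 leqNgt ltn_neqAle le_nf Hm eq_sym Hn /=.
  by rewrite mul0r mulr0.
case/andP: Hn => Hs /eqP Hd.
rewrite -[RHS](semigroup_ideal_weight Ip (wt n)) [LHS]big_mkcond [RHS]big_mkcond /=.
rewrite !big_seq; apply: eq_bigr => m Hm; rewrite !mcoeffZ mcoeffX nf_eq Hs /=.
case: (wt m =P wt n) => [E|_]; last by rewrite !mulr0; case: ifP.
have /eqP En : nf m == n by rewrite nf_eq Hs E eqxx.
have Em : mdeg m = d.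
  by apply/eqP; rewrite eqn_leq (mindeg_leq Hm) andbT -Hd -En le_nf.
by rewrite Em eqxx En Hd subnn expr0 !mulr1.
Qed.

Lemma diff1_expand eps r (f g : {poly S}) : d1 eps r f g =
  r * ('X_[mon 0 1 1 0] - 'X_[mon 1 0 0 1]) +
  \sum_(i < k.+2) f`_i * ('X_[mon 0 0 (h - i) i] - eps *: 'X_[mon (h - i).+1 i 0 0]) +
  \sum_(i < k.+1) g`_i * ('X_[mon 0 (k - i).+2 0 i] - 'X_[mon (k - i).+1 0 i.+1 0]).
Proof.
rewrite /diff1; congr (_ + _ + _).
- by rewrite !mpolyX_mon; ring.
- rewrite /homeval mulr_sumr -sumrB; apply: eq_bigr => i _.
  by rewrite !mpolyX_mon -mul_mpolyC !exprS; ring.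
- rewrite /homeval !mulr_sumr -sumrB; apply: eq_bigr => i _.
  by rewrite !mpolyX_mon !exprS; ring.
Qed.

(** All generators have one shape: a binomial of equal weights whose second term carries [eps] to
    the increase of degree. At [eps = 1] these lie in the kernel, and at [eps = 0] they are initial
    forms of such binomials. *)
Lemma ideal_J_ind eps (P : S -> Prop) :
  P 0 -> (forall p q, P p -> P q -> P (p + q)) ->
  (forall s m m', m != m' -> wt m = wt m' -> (mdeg m <= mdeg m')%N ->
     P (s * ('X_[m] - eps ^+ (mdeg m' - mdeg m) *: 'X_[m']))) ->
  forall p, J eps p -> P p.
Proof.
move=> P0 PD Pgen p [r [f [g [_ _ ->]]]]; rewrite diff1_expand.
apply: (PD); [apply: (PD)|].
- have [Hw Hd _] := rewrites_quadric K k 0 0 0 0.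
  have := Pgen r _ _ _ Hw Hd; rewrite !mdeg_mon subnn expr0 scale1r; apply.
  by apply/eqP => /(congr1 (fun m : 'X_{1..4} => m X0)).
- elim/big_ind: _ => // i _.
  have [Hw Hd _] : rewrites K k (mon 0 0 (h - i) i) (mon (h - i).+1 i 0 0).
    by apply: (@rewrites_F _ _ i) => //; rewrite ?add0n // -ltnS.
  have := Pgen f`_i _ _ _ Hw Hd; rewrite !mdeg_mon (_ : (_ + _ - _ = 1)%N); last by lia.
  rewrite expr1; apply.
  by apply/eqP => /(congr1 (fun m : 'X_{1..4} => m X0)).
- elim/big_ind: _ => // i _.
  have [Hw Hd _] : rewrites K k (mon 0 (k - i).+2 0 i) (mon (k - i).+1 0 i.+1 0).
    by apply: (@rewrites_G _ _ i) => //; rewrite ?add0n // -ltnS.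
  have := Pgen g`_i _ _ _ Hw Hd; rewrite !mdeg_mon (_ : (_ + _ - _ = 0)%N); last by lia.
  rewrite expr0 scale1r; apply.
  by apply/eqP => /(congr1 (fun m : 'X_{1..4} => m X0)).
Qed.

Lemma semigroup_ideal_J p : I_A p <-> J 1 p.
Proof.
split; first exact: semigroup_ideal_sub.
apply: ideal_J_ind => [|p1 p2|s m m' _ Hw _].
- exact: rmorph0.
- exact: semigroup_idealD.
- by rewrite expr1n scale1r; apply: semigroup_idealM; apply: semigroup_ideal_binomial.
Qed.

Lemma initial_ideal_J p : initial_ideal I_A p <-> J 0 p.
Proof.
split=> [[s Hs ->]|].
  rewrite big_seq; apply: ideal_J_sum => q /Hs [_ Iq].
  by apply: ideal_JM; apply: initial_form_sub.
apply: ideal_J_ind => [|p1 p2|s m m' ne Hw Hd].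
- exact: initial_ideal0.
- exact: initial_idealD.
- rewrite -initial_form_binomial //; apply: initial_idealM.
    exact: semigroup_ideal_binomial.
  exact: binomial_neq0.
Qed.

End Identification.

Local Close Scope ring_scope.

Theorem proposition8p3 (K : fieldType) (h : nat) (h_ge2 : 2 <= h) :
  let I := @semigroup_ideal K 4 (A_gens h) in
  let s := [:: 1; 2 * h + 2; 4 * h; 2 * h - 1] in
  betti_sequence I s /\ betti_sequence (initial_ideal I) s.
Proof.
case: h h_ge2 => [|k] // k_gt0 I s.
have Es : s = [:: 1; 1 + (k.+2 + k.+1); k.+1 + k.+1 + (k.+1 + k.+1); k + k.+1].
  by rewrite /s; do 4?congr (_ :: _); lia.
split; rewrite Es.
  by apply: (betti_sequence_of_J (eps := 1%R)) => // p; exact: semigroup_ideal_J.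
by apply: (betti_sequence_of_J (eps := 0%R)) => // p; exact: initial_ideal_J.
Qed.
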